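(* Let $n\in\mathbb N$, $l\ge 1$, $\mathbf v=(v_1,\dots,v_l)\in\mathbb Z^l$ with $v_1\ge\dots\ge v_l$, and let $k_2<k_3<\dots<k_r$ be integers in $\{2,\dots,l\}$ such that $v_{k_j-1}-v_{k_j}\ge n$ for all $j=2,\dots,r$. Put $k_1=1$, $k_{r+1}=l+1$ and $\mathbf v^j=(v_{k_j},\dots,v_{k_{j+1}-1})$ for $j=1,\dots,r$. Let $S$ be a standard symbol of multicharge $\mathbf v$ and size $n$, and write $S=(S_1,\dots,S_r)$, where $S_j$ is a standard symbol of multicharge $\mathbf v^j$ and size $n_j$ (it consists of the rows $k_j,\dots,k_{j+1}-1$ of $S$), with $n_1+\dots+n_r=n$. For each $j$ write the canonical basis element $G(S_j)$ as $$G(S_j)=\sum_{\underline i\in J(S_j)}a_{\underline i}^{S_j}(q)\,F_{\underline i}\cdot\emptyset_{\mathbf v^j}=\sum_{T\in\mathcal S_{\mathbf v^j}(n_j)}\alpha^j_{S_j,T}(q)\,T,$$ where $J(S_j)$ is a certain subset of $\mathbb Z^{n_j}$, the $a^{S_j}_{\underline i}(q)\in\mathbb Z[q,q^{-1}]$ are bar invariant (i.e. invariant under $q\mapsto q^{-1}$), and $\alpha^j_{S_j,T}(q)\in\mathbb Z[q]$. Then $$G(S)=\sum_{(\underline i_1,\dots,\underline i_r)\in J(S_1)\times\dots\times J(S_r)}a^{S_1}_{\underline i_1}(q)\cdots a^{S_r}_{\underline i_r}(q)\,F_{\underline i_1}\cdots F_{\underline i_r}\cdot\emptyset_{\mathbf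 v}$$ $$=\sum_{(T_1,\dots,T_r)\in\mathcal S_{\mathbf v^1}(n_1)\times\dots\times\mathcal S_{\mathbf v^r}(n_r)}\alpha^1_{S_1,T_1}(q)\cdots\alpha^r_{S_r,T_r}(q)\,(T_1,\dots,T_r).$$
   Context: Symbols. For $s\in\mathbb Z$, $\mathfrak B_s$ is the set of strictly increasing integer sequences $\beta=(\beta_j)_{j\le s}$ with $\beta_j=j$ for all sufficiently negative $j$; such a sequence is also viewed as the set of its values. A symbol of multicharge $\mathbf v=(v_1\ge\dots\ge v_l)$ is a tuple $S=(\beta^1,\dots,\beta^l)$ with $\beta^i=(\beta^i_j)_{j\le v_i}\in\mathfrak B_{v_i}$; $\beta^i$ is the $i$-th row (row 1 on top). Its size is $\sum_i\sum_{j\le v_i}(\beta^i_j-j)$. $\mathcal S_{\mathbf v}$ is the set of symbols of multicharge $\mathbf v$, $\mathcal S_{\mathbf v}(n)$ the set of those of size $n$, and $\emptyset_{\mathbf v}$ the symbol of size $0$. $S$ is standard if $\beta^i_j\le\beta^{i+1}_j$ for all $1\le i<l$ and $j\le v_{i+1}$. $(T_1,\dots,T_r)$ denotes the symbol obtained by stacking the rows of $T_1,\dots,T_r$ in this order. Fock space. $\mathcal F_{\mathbf v}$ is the $\mathbb Q(q)$-vector space with basis $\mathcal S_{\mathbf v}$. It is a module over the quantum group $U_q(\mathfrak{gl}_\infty)$ (the tensor product $V(\Lambda_{v_1})\otimes\dots\otimes V(\Lambda_{v_l})$ of the irreducible highest weight modules of fundamental weights $\Lambda_{v_i}$), in which,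 for $i\in\mathbb Z$, the Chevalley generator $F_i$ acts by $$F_i\cdot S=\sum_{S'}q^{\#\{k>j\,:\,i\in\beta^k\}-\#\{k>j\,:\,i+1\in\beta^k\}}S',$$ the sum being over all symbols $S'$ obtained from $S=(\beta^1,\dots,\beta^l)$ by replacing, in a single row $j$, an entry $i$ by $i+1$ (this requires $i\in\beta^j$, $i+1\notin\beta^j$). For $a\ge 0$, $F_i^{(a)}=F_i^a/[a]!$ with $[r]=(q^r-q^{-r})/(q-q^{-1})$ and $[a]!=[a][a-1]\cdots[1]$. For a finite integer sequence $\underline i=(i_1,\dots,i_1,\dots,i_m,\dots,i_m)$ with $i_j$ repeated $a_j$ times and $i_j\neq i_{j+1}$, $F_{\underline i}=F_{i_1}^{(a_1)}\cdots F_{i_m}^{(a_m)}$. Canonical basis. $V_{\mathbf v}\subset\mathcal F_{\mathbf v}$ is the $U_q(\mathfrak{gl}_\infty)$-submodule generated by $\emptyset_{\mathbf v}$, i.e. the $\mathbb Q(q)$-span of all $F_{i_1}\cdots F_{i_m}\cdot\emptyset_{\mathbf v}$; it is the irreducible module of highest weight $\Lambda_{v_1}+\dots+\Lambda_{v_l}$. The bar involution $u\mapsto\overline u$ of $V_{\mathbf v}$ is the unique $\mathbb Q$-linear map with $\overline{f(q)u}=f(q^{-1})\overline u$ for $f(q)\in\mathbb Q(q)$, $\overline{F_i u}=F_i\overline u$ and $\overline{\emptyset_{\mathbf v}}=\emptyset_{\mathbf v}$. Let $R\subset\mathbb Q(q)$ be the ring of rational functions regular at $q=0$, and $\mathcal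 F_{\mathbf v,R}$ the $R$-span of the symbols in $\mathcal F_{\mathbf v}$. The canonical basis of $V_{\mathbf v}$ (in the sense of Lusztig) is the unique basis $\{G(S)\}$ of $V_{\mathbf v}$, indexed by the standard symbols $S\in\mathcal S_{\mathbf v}$, such that $\overline{G(S)}=G(S)$ and $G(S)\equiv S \bmod q\mathcal F_{\mathbf v,R}$. The same definitions apply to each multicharge $\mathbf v^j$.
   Formalization: Every sequence in J(S_j) is assumed to give a nonzero vector F_i·∅_{v^j} (for arbitrary J the first formula can fail), and the canonical basis is also required to be a Z[q,q^-1]-basis of the integral form spanned by divided-power monomials, without which it is not unique. *)

(* Defs.v *)
From HB Require Import structures.
From mathcomp Require Import all_boot all_order all_algebra.
From mathcomp Require Import finmap.
From mathcomp Require Import mathcomp_extra boolp classical_sets cardinality fsbigop.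
From mathcomp Require Import monalg zify.

Set Implicit Arguments.
Unset Strict Implicit.
Unset Printing Implicit Defensive.

Import Order.TTheory GRing.Theory Num.Theory.

Local Open Scope classical_set_scope.
Local Open Scope ring_scope.

(* A sequence (beta_j)_(j <= s) is stored downwards from its last term:
   entry k = beta_(s-k). *)
Record row := Row {
  charge : int;
  entry : nat -> int;
  entry_decr : forall k : nat, entry k.+1 < entry k;
  entry_eventually :
    exists N : nat, forall k : nat, (N <= k)%N -> entry k = charge - k%:Z
}.

HB.instance Definition _ := gen_eqMixin row.
HB.instance Definition _ := gen_choiceMixin row.

(* beta_j; only meaningful for j <= charge b *)
Definition row_at (b : row) (j : int) : int := entry b (absz (charge b - j)).

Definition row_mem (b : row) (i : int) : bool := `[< exists k : nat, entry b k = i >].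

Definition row_size (b : row) : int :=
  \sum_(k \in [set: nat]) (entry b k - (charge b - k%:Z)).

Lemma empty_row_decr (s : int) (k : nat) : s - k.+1%:Z < s - k%:Z.
Proof. by rewrite ltrD2l ltrN2 ltz_nat. Qed.

Lemma empty_row_eventually (s : int) :
  exists N : nat, forall k : nat, (N <= k)%N -> s - k%:Z = s - k%:Z.
Proof. by exists 0%N. Qed.

Definition empty_row (s : int) : row :=
  @Row s (fun k => s - k%:Z) (empty_row_decr s) (empty_row_eventually s).

Definition movable (b : row) (i : int) : bool := row_mem b i && ~~ row_mem b (i + 1).

Definition raise_entry (b : row) (i : int) (k : nat) : int :=
  if movable b i && (entry b k == i) then i + 1 else entry b k.

Lemma raise_entry_decr (b : row) (i : int) (k : nat) :
  raise_entry b i k.+1 < raise_entry b i k.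
Proof.
rewrite /raise_entry; have lt_b := entry_decr b k.
case: (boolP (movable b i)) => [/andP[_ ni1]|_] //=.
have ne : entry b k <> i + 1.
  by move=> e; case/negP: ni1; apply/asboolP; exists k.
by case: eqP => e1; case: eqP => e0; lia.
Qed.

Lemma raise_entry_eventually (b : row) (i : int) :
  exists N : nat, forall k : nat, (N <= k)%N -> raise_entry b i k = charge b - k%:Z.
Proof.
have [N HN] := entry_eventually b.
exists (N + absz (charge b - i)).+1 => k lek; rewrite /raise_entry HN; last first.
  by apply: leq_trans lek; rewrite -addnS leq_addr.
case: eqP => [ei|_]; last by rewrite andbF.
by lia.
Qed.

(* b with its entry i replaced by i+1 when i is in b and i+1 is not; otherwise b *)
Definition raise_row (b : row) (i : int) : row :=
  @Row (charge b) (raise_entry b i) (raise_entry_decr b i) (raise_entry_eventually b i).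

(* The rows of a symbol, from top to bottom. *)
Definition symbol := seq row.

Definition multicharge (S : symbol) : seq int := map charge S.

Definition symbols (v : seq int) : set symbol := [set S | multicharge S = v].

Definition symbol_size (S : symbol) : int := \sum_(b <- S) row_size b.

Definition symbols_of_size (v : seq int) (n : nat) : set symbol :=
  [set S | symbols v S /\ symbol_size S = n%:Z].

Definition empty_symbol (v : seq int) : symbol := map empty_row v.

(* The i-th row, counted from 0. *)
Definition nth_row (S : symbol) (i : nat) : row := nth (empty_row 0) S i.

Definition standard (S : symbol) : Prop :=
  forall i : nat, (i.+1 < size S)%N ->
  forall j : int, j <= charge (nth_row S i.+1) ->
    row_at (nth_row S i) j <= row_at (nth_row S i.+1) j.

Definition standard_symbols (v : seq int) : set symbol :=
  [set S | symbols v S /\ standard S].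

Definition stack (r : nat) (T : 'I_r -> symbol) : symbol :=
  flatten [seq T j | j <- enum 'I_r].

Definition Qq : fieldType := {fraction {poly rat}}.

Definition frac_of (p : {poly rat}) : Qq := FracField.tofrac p.

Definition q : Qq := frac_of 'X.

Definition polyZ (p : {poly int}) : Qq := frac_of (map_poly (fun c : int => c%:~R) p).

(* p(1/q) *)
Definition eval_qinv (p : {poly rat}) : Qq :=
  (map_poly (fun c : rat => frac_of c%:P) p).[q^-1].

(* f(q) |-> f(1/q), computed on a representing fraction of f *)
Definition qbar (f : Qq) : Qq :=
  eval_qinv (frac (repr f)).1 / eval_qinv (frac (repr f)).2.

Definition laurentZ : set Qq :=
  [set f | exists (p : {poly int}) (m : nat), f = polyZ p / q ^+ m].

Definition regular_at0 : set Qq :=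
  [set f | exists a b : {poly rat}, b.[0] != 0 /\ f = frac_of a / frac_of b].

Definition qint (a : nat) : Qq := (q ^+ a - q ^- a) / (q - q^-1).

Definition qfact (a : nat) : Qq := \prod_(1 <= c < a.+1) qint c.

(* The direct sum of the spaces F_v over all multicharges v: the summand F_v
   is spanned by symbols v and is stable under the operators F_i. *)
Definition Fock : lmodType Qq := {malg Qq[symbol]}.

Definition ket (S : symbol) : Fock := << S >>.

Definition vac (v : seq int) : Fock := ket (empty_symbol v).

(* drop j.+1 S consists of the rows strictly below row j *)
Definition F_exponent (i : int) (S : symbol) (j : nat) : int :=
  (count (fun b => row_mem b i) (drop j.+1 S))%:Z
  - (count (fun b => row_mem b (i + 1)) (drop j.+1 S))%:Z.

Definition F_ket (i : int) (S : symbol) : Fock :=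
  \sum_(j < size S | movable (nth_row S j) i)
     q ^ F_exponent i S j *:
       ket (set_nth (empty_row 0) S j (raise_row (nth_row S j) i)).

Definition F (i : int) (u : Fock) : Fock :=
  \sum_(S <- msupp u) mcoeff S u *: F_ket i S.

Definition F_div (i : int) (a : nat) (u : Fock) : Fock :=
  (qfact a)^-1 *: iter a (F i) u.

(* The maximal runs of a sequence, as pairs (value, length). *)
Fixpoint runs (s : seq int) : seq (int * nat) :=
  if s is i :: s' then
    if runs s' is (i', a) :: t then
      if i == i' then (i, a.+1) :: t else (i, 1%N) :: (i', a) :: t
    else [:: (i, 1%N)]
  else [::].

(* F_(i_1)^(a_1) ... F_(i_m)^(a_m), the last factor acting first *)
Definition F_seq (s : seq int) (u : Fock) : Fock :=
  foldr (fun p w => F_div p.1 p.2 w) u (runs s).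

(* F_(i_1) ... F_(i_r), where each i_j is a sequence *)
Definition F_seqs (r : nat) (I : 'I_r -> seq int) (u : Fock) : Fock :=
  foldr (fun j w => F_seq (I j) w) u (enum 'I_r).

Definition span (A : set Qq) (X : set Fock) : set Fock :=
  [set u | exists (m : nat) (c : 'I_m -> Qq) (x : 'I_m -> Fock),
      (forall i, A (c i) /\ X (x i)) /\ u = \sum_(i < m) c i *: x i].

(* (x_S)_(S in D) is a basis over A of W *)
Definition is_basis (A : set Qq) (D : set symbol) (x : symbol -> Fock)
    (W : set Fock) : Prop :=
  span A (x @` D) = W /\
  forall (s : seq symbol) (c : symbol -> Qq), uniq s ->
    (forall S, S \in s -> D S /\ A (c S)) ->
    \sum_(S <- s) c S *: x S = 0 -> forall S, S \in s -> c S = 0.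

Definition V (v : seq int) : set Fock :=
  span setT [set u | exists s : seq int, u = foldr F (vac v) s].

(* The Z[q,1/q]-form of V v, generated by the divided powers. *)
Definition V_Z (v : seq int) : set Fock :=
  span laurentZ [set u | exists s : seq int, u = F_seq s (vac v)].

Definition F_R (v : seq int) : set Fock := span regular_at0 (ket @` symbols v).

(* Only the restriction of psi to V v matters. *)
Definition is_bar_involution (v : seq int) (psi : Fock -> Fock) : Prop :=
  [/\ forall u, V v u -> V v (psi u),
      forall u w, V v u -> V v w -> psi (u + w) = psi u + psi w,
      forall f u, V v u -> psi (f *: u) = qbar f *: psi u,
      forall i u, V v u -> psi (F i u) = F i (psi u)
    & psi (vac v) = vac v].

(* Bar invariance and the congruence modulo q do not by themselves determine
   the G S: q/(1+q^2) is bar invariant, regular at 0 and vanishes there, so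
   G S + q/(1+q^2) G T satisfies the same two conditions. As in Lusztig's definition,
   a canonical basis is moreover a Z[q,1/q]-basis of the integral form of V v,
   which makes it unique. *)
Definition is_canonical_basis (v : seq int) (G : symbol -> Fock) : Prop :=
  [/\ is_basis setT (standard_symbols v) G (V v),
      is_basis laurentZ (standard_symbols v) G (V_Z v),
      exists2 psi, is_bar_involution v psi &
        forall S, standard_symbols v S -> psi (G S) = G S
    & forall S, standard_symbols v S ->
        exists2 w, F_R v w & G S - ket S = q *: w].

(* The terms of s in positions a, ..., b-1, positions being counted from 1. *)
Definition slice (T : Type) (s : seq T) (a b : nat) : seq T :=
  take (b - a) (drop a.-1 s).

(* Main.v *)
(* Let X be the tensor product of the G(S_j), i.e. the right-hand side of the second
   formula.  The gaps v_(k_j - 1) - v_(k_j) >= n separate the contents: every i in a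
   sequence of J(S_a) is larger than all the entries that at most n_b moves can
   produce in a block b below a, and every such i is too small to be movable in
   the vacuum rows above block a.  Hence F_(i_1) ... F_(i_r) acts on the vacuum factor by
   factor, which is the first formula for X.  It shows that X is bar invariant and
   lies in the integral form, while X = S modulo q because this holds for each
   factor.  These properties characterize G(S): the coordinates d of X - G(S) in the
   canonical basis are bar invariant Laurent polynomials, and unitriangularity modulo q
   forces them into qR (removing powers of 1/q one at a time), so d = 0. *)

Require Import Defs.
From HB Require Import structures.
From mathcomp Require Import all_boot all_order all_algebra.
From mathcomp Require Import finmap.
From mathcomp Require Import mathcomp_extra boolp classical_sets cardinality fsbigop.
From mathcomp Require Import monalg zify ring.

Set Implicit Arguments.
Unset Strict Implicit.
Unset Printing Implicit Defensive.

Import Order.TTheory GRing.Theory Num.Theory.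

Local Open Scope classical_set_scope.
Local Open Scope ring_scope.

(** * Tensor products of Fock spaces *)

(** [F i] unfolds to [lext (F_ket i)], so the linearity proved for [lext] is also that of the
    Chevalley generators. *)
Definition lext (f : symbol -> Fock) (u : Fock) : Fock :=
  \sum_(S <- msupp u) mcoeff S u *: f S.

(** Lets the sums for several vectors run over one common finite set, where they can be added term
    by term. *)
Lemma lextEw (f : symbol -> Fock) (u : Fock) (D : {fset symbol}) :
  (msupp u `<=` D)%fset -> lext f u = \sum_(S <- D) mcoeff S u *: f S.
Proof.
move=> sub; rewrite /lext (big_fset_incl _ sub) // => S _ Su.
by rewrite mcoeff_outdom // scale0r.
Qed.

Lemma lext_linear f : linear (lext f).
Proof.
move=> c u w; set D := (msupp (c *: u + w) `|` (msupp u `|` msupp w))%fset.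
rewrite (@lextEw _ _ D) ?fsubsetUl // (@lextEw _ u D); last first.
  by rewrite /D fsubsetU // fsubsetUl orbT.
rewrite (@lextEw _ w D); last by rewrite /D fsubsetU // fsubsetUr orbT.
rewrite scaler_sumr -big_split; apply: eq_bigr => S _ /=.
by rewrite mcoeffD mcoeffZ scalerDl scalerA.
Qed.

HB.instance Definition _ f :=
  GRing.isLinear.Build Qq Fock Fock _ (lext f) (@lext_linear f).

Lemma mcoeff_ket (S T : symbol) : mcoeff T (ket S) = (S == T)%:R.
Proof. exact: mcoeffU. Qed.

Lemma lext_ket f S : lext f (ket S) = f S.
Proof.
by rewrite /lext msuppU oner_eq0 big_seq_fset1 mcoeff_ket eqxx scale1r.
Qed.

Lemma sum_ketE (u : Fock) : u = \sum_(S <- msupp u) mcoeff S u *: ket S.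
Proof.
apply/malgP => T; rewrite (big_morph _ (mcoeffD T) (mcoeff0 _)).
under eq_bigr do rewrite mcoeffZ mcoeff_ket.
case: (msuppP u T) => Tu; last first.
  rewrite big1_seq // => S /andP[_ Su]; case: eqP => [eST|]; last by rewrite mulr0.
  by rewrite -eST Su in Tu.
rewrite (big_fsetD1 T) //= eqxx mulr1 big1_seq ?addr0 // => S /andP[_].
by rewrite !inE => /andP[/negPf -> _]; rewrite mulr0.
Qed.

Lemma linear_ket_ext (f g : {linear Fock -> Fock}) :
  (forall S, f (ket S) = g (ket S)) -> f =1 g.
Proof.
move=> fg u; rewrite [u]sum_ketE !linear_sum; apply: eq_bigr => S _.
by rewrite !linearZ fg.
Qed.

HB.instance Definition _ i := GRing.isLinear.Build Qq Fock Fock _ (F i)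
  (lext_linear (F_ket i)).

Lemma F0 i : F i 0 = 0.
Proof. exact: linear0. Qed.

Lemma FZ i c u : F i (c *: u) = c *: F i u.
Proof. exact: linearZ. Qed.

Lemma F_sum i (I : Type) (r : seq I) (P : pred I) (f : I -> Fock) :
  F i (\sum_(j <- r | P j) f j) = \sum_(j <- r | P j) F i (f j).
Proof. exact: linear_sum. Qed.

Lemma F_ketE i S : F i (ket S) = F_ket i S.
Proof. exact: lext_ket. Qed.

(* The tensor product of F_v and F_w, identified with F_(v ++ w). *)
HB.lock Definition tens (u w : Fock) : Fock :=
  lext (fun S => lext (fun T => ket (S ++ T)) w) u.

Lemma tens_ket S T : tens (ket S) (ket T) = ket (S ++ T).
Proof. by rewrite tens.unlock !lext_ket. Qed.

Lemma tensPl w : linear (tens^~ w).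
Proof. rewrite tens.unlock; exact: lext_linear. Qed.

Lemma tensPr u : linear (tens u).
Proof.
move=> c w w'; rewrite tens.unlock /lext scaler_sumr -big_split; apply: eq_bigr => S _ /=.
rewrite -!/(lext _ _) linearP.
by rewrite scalerDr !scalerA mulrC.
Qed.

HB.instance Definition _ u :=
  GRing.isLinear.Build Qq Fock Fock _ (tens u) (@tensPr u).

(** The arguments are swapped so that linearity in the left factor can be registered as an
    instance. *)
Definition tensr (w u : Fock) : Fock := tens u w.

HB.instance Definition _ w :=
  GRing.isLinear.Build Qq Fock Fock _ (tensr w) (@tensPl w).

Lemma tensDl : left_distributive tens +%R.
Proof. by move=> u u' w; exact: (linearD (tensr w)). Qed.

Lemma tensDr : right_distributive tens +%R.
Proof. by move=> u w w'; exact: linearD. Qed.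

Lemma tens0l : left_zero 0 tens.
Proof. by move=> w; exact: (linear0 (tensr w)). Qed.

Lemma tens0r : right_zero 0 tens.
Proof. by move=> w; exact: linear0. Qed.

Lemma tensZl c u w : tens (c *: u) w = c *: tens u w.
Proof. exact: (linearZ_LR (tensr w)). Qed.

Lemma tensZr c u w : tens u (c *: w) = c *: tens u w.
Proof. exact: linearZ. Qed.

Lemma tens_suml (I : Type) (r : seq I) (P : pred I) (f : I -> Fock) w :
  tens (\sum_(j <- r | P j) f j) w = \sum_(j <- r | P j) tens (f j) w.
Proof. exact: (linear_sum (tensr w)). Qed.

Lemma tens_sumr (I : Type) (r : seq I) (P : pred I) (f : I -> Fock) u :
  tens u (\sum_(j <- r | P j) f j) = \sum_(j <- r | P j) tens u (f j).
Proof. exact: linear_sum. Qed.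

(** Bilinearity reduces the comparison to pairs of basis vectors, one argument at a time. *)
Lemma tens_ind (f g : Fock -> Fock -> Fock) :
  (forall w, linear (f^~ w)) -> (forall w, linear (g^~ w)) ->
  (forall u, linear (f u)) -> (forall u, linear (g u)) ->
  (forall S T, f (ket S) (ket T) = g (ket S) (ket T)) -> f =2 g.
Proof.
move=> fl gl fr gr fg u w.
pose fl' w := HB.pack_for {linear Fock -> Fock} (f^~ w)
  (GRing.isLinear.Build Qq Fock Fock _ (f^~ w) (fl w)).
pose gl' w := HB.pack_for {linear Fock -> Fock} (g^~ w)
  (GRing.isLinear.Build Qq Fock Fock _ (g^~ w) (gl w)).
apply: (linear_ket_ext (f := fl' w) (g := gl' w)) => S /=.
pose fr' w := HB.pack_for {linear Fock -> Fock} (f w)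
  (GRing.isLinear.Build Qq Fock Fock _ (f w) (fr w)).
pose gr' w := HB.pack_for {linear Fock -> Fock} (g w)
  (GRing.isLinear.Build Qq Fock Fock _ (g w) (gr w)).
by apply: (linear_ket_ext (f := fr' (ket S)) (g := gr' (ket S))) => T /=.
Qed.

Lemma tensA : associative tens.
Proof.
move=> u w x; move: u w; apply: tens_ind => [w|w|u|u|S T].
- exact: tensPl.
- by move=> c u u'; rewrite tensPl tensPl.
- by move=> c w w'; rewrite tensPl tensPr.
- by move=> c w w'; rewrite tensPr tensPl.
pose g : {linear Fock -> Fock} := tens (tens (ket S) (ket T)).
apply: (linear_ket_ext (f := tens (ket S) \o tens (ket T)) (g := g)) => R /=.
by rewrite /g /= !tens_ket catA.
Qed.

Lemma tens1l : left_id (ket [::]) tens.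
Proof.
move=> u; apply: (linear_ket_ext (f := tens (ket [::])) (g := idfun)) => S.
exact: tens_ket.
Qed.

Lemma tens1r : right_id (ket [::]) tens.
Proof.
move=> u; apply: (linear_ket_ext (f := tensr (ket [::])) (g := idfun)) => S /=.
by rewrite /tensr tens_ket cats0.
Qed.

(** The symbol without rows is the unit; with these laws [\big[tens/ket [::]]] denotes an iterated
    tensor product. *)
HB.instance Definition _ := Monoid.isLaw.Build Fock (ket [::]) tens tensA tens1l tens1r.
HB.instance Definition _ := Monoid.isMulLaw.Build Fock 0 tens tens0l tens0r.

(* A copy of [+%R]: the library already declares [+%R] to distribute over ring
   multiplication, which prevents inferring that it distributes over [tens]. *)
Definition addF : Fock -> Fock -> Fock := +%R.

HB.instance Definition _ := Monoid.isComLaw.Build Fock 0 addF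
  (@addrA Fock) (@addrC Fock) (@add0r Fock).
HB.instance Definition _ := Monoid.isAddLaw.Build Fock tens addF tensDl tensDr.


(* [q ^ below_exponent i T] is the factor that T contributes when F_i acts on a row
   above it: F_i acts on a tensor product through [F_i (x) K_i + 1 (x) F_i]. *)
Definition below_exponent (i : int) (T : symbol) : int :=
  (count (fun b => row_mem b i) T)%:Z - (count (fun b => row_mem b (i + 1)) T)%:Z.

Definition move_ket (i : int) (S : symbol) (j : nat) : Fock :=
  q ^ F_exponent i S j *:
    ket (set_nth (empty_row 0) S j (raise_row (nth_row S j) i)).

(** Indexing by natural numbers allows the sum over the rows of a concatenation to be cut at
    [size S]. *)
Lemma F_ket_nat i S :
  F_ket i S = \sum_(0 <= j < size S | movable (nth_row S j) i) move_ket i S j.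
Proof. by rewrite big_mkord. Qed.

Lemma q_neq0 : q != 0.
Proof. by rewrite /q /frac_of tofrac_eq0 polyX_eq0. Qed.

Lemma set_nth_catl (T : Type) (x0 y : T) (s t : seq T) j : (j < size s)%N ->
  set_nth x0 (s ++ t) j y = set_nth x0 s j y ++ t.
Proof. by elim: s j => // a s IH [|j] //= lt_j; rewrite IH. Qed.

Lemma set_nth_catr (T : Type) (x0 y : T) (s t : seq T) j :
  set_nth x0 (s ++ t) (j + size s) y = s ++ set_nth x0 t j y.
Proof. by elim: s => [|a s IH]; rewrite ?addn0 // addnS /= IH. Qed.

Lemma scale_exprzD (K : fieldType) (W : lmodType K) (x : K) (m p : int) (w : W) :
  x != 0 -> x ^ (m + p) *: w = x ^ m *: (x ^ p *: w).
Proof. by move=> x0; rewrite scalerA expfzDr. Qed.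

(** All rows of T lie below row j, so they multiply the coefficient by the factor of T. *)
Lemma move_ket_catl i S T j : (j < size S)%N ->
  move_ket i (S ++ T) j = q ^ below_exponent i T *: tens (move_ket i S j) (ket T).
Proof.
move=> jS; rewrite /move_ket /nth_row nth_cat jS tensZl tens_ket.
have -> : F_exponent i (S ++ T) j = below_exponent i T + F_exponent i S j.
  rewrite /F_exponent /below_exponent drop_cat.
  case: (ltnP j.+1 (size S)) => [_|le]; first by rewrite !count_cat; lia.
  have -> : (j.+1 - size S)%N = 0%N by lia.
  by rewrite drop0 (drop_oversize le) /=; lia.
by rewrite (scale_exprzD _ _ _ q_neq0) set_nth_catl.
Qed.

(** The rows of S lie above the moved row and do not enter its exponent. *)
Lemma move_ket_catr i S T j :
  move_ket i (S ++ T) (j + size S) = tens (ket S) (move_ket i T j).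
Proof.
have le : (size S <= j + size S)%N by lia.
rewrite /move_ket /nth_row nth_cat ltnNge le /= addnK tensZr tens_ket set_nth_catr.
have -> // : F_exponent i (S ++ T) (j + size S) = F_exponent i T j.
rewrite /F_exponent drop_cat ltnNge (leq_trans le (leqnSn _)) /=.
by rewrite subSn // addnK.
Qed.

(** This is the coproduct of F_i, obtained by splitting the sum over the rows into those of S and
    those of T. *)
Lemma F_ket_cat i S T : F_ket i (S ++ T) =
  q ^ below_exponent i T *: tens (F_ket i S) (ket T) + tens (ket S) (F_ket i T).
Proof.
rewrite !F_ket_nat (@big_cat_nat _ _ _ (size S)) ?size_cat ?leq_addr //=.
rewrite tens_suml tens_sumr [X in _ = X + _]scaler_sumr.
apply: (f_equal2 (fun u w : Fock => u + w)).
  rewrite [LHS]big_nat_cond; apply/esym; rewrite [LHS]big_nat_cond; apply: eq_big => j.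
    by rewrite /nth_row nth_cat; case: (ltnP j (size S)).
  by case/andP=> /andP[_ jS] _; rewrite move_ket_catl.
rewrite addnC -{1}[size S]add0n big_addn addnK; apply: eq_big => j.
  by rewrite /nth_row nth_cat ltnNge leq_addl addnK.
by move=> _; apply: move_ket_catr.
Qed.

(** * Action of the Chevalley generators on tensor products *)

Definition supported (P : symbol -> Prop) (u : Fock) : Prop :=
  forall S, S \in msupp u -> P S.

Lemma supported0 P : supported P 0.
Proof. by move=> S; rewrite msupp0. Qed.

Lemma supportedD P u w : supported P u -> supported P w -> supported P (u + w).
Proof.
move=> Pu Pw S /(fsubsetP (msuppD_le u w)); rewrite inE.
by case/orP => [/Pu|/Pw].
Qed.

Lemma supportedZ P c u : supported P u -> supported P (c *: u).
Proof. by move=> Pu S /(fsubsetP (msuppZ_le c u))/Pu. Qed.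

Lemma supported_sum P (I : eqType) (s : seq I) (A : pred I) (f : I -> Fock) :
  (forall x, x \in s -> A x -> supported P (f x)) ->
  supported P (\sum_(x <- s | A x) f x).
Proof.
move=> Pf; rewrite big_seq_cond; elim/big_rec: _ => [|x u /andP[xs Ax] Pu].
  exact: supported0.
by apply: supportedD => //; apply: Pf.
Qed.

Lemma supported_ket (P : symbol -> Prop) S : P S -> supported P (ket S).
Proof. by move=> PS T; rewrite msuppU oner_eq0 inE => /eqP->. Qed.

Lemma supported_tens (P Q R : symbol -> Prop) u w :
  (forall S T, P S -> Q T -> R (S ++ T)) ->
  supported P u -> supported Q w -> supported R (tens u w).
Proof.
move=> PQR Pu Qw; rewrite [u]sum_ketE [w]sum_ketE tens_suml.
apply: supported_sum => S Su _; rewrite tens_sumr.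
apply: supported_sum => T Tw _; rewrite tensZl tensZr tens_ket.
by do 2!apply: supportedZ; apply: supported_ket; apply: PQR; [apply: Pu|apply: Qw].
Qed.

Lemma F_supported (P Q : symbol -> Prop) i u :
  (forall S, P S -> supported Q (F_ket i S)) -> supported P u -> supported Q (F i u).
Proof.
move=> PQ Pu; apply: supported_sum => S Su _.
by apply: supportedZ; apply: PQ; apply: Pu.
Qed.

Lemma F_tens_ket i S T : F i (tens (ket S) (ket T)) =
  q ^ below_exponent i T *: tens (F i (ket S)) (ket T) + tens (ket S) (F i (ket T)).
Proof. by rewrite tens_ket !F_ketE F_ket_cat. Qed.

Lemma F_ket_eq0 i S : (forall b, b \in S -> ~~ movable b i) -> F_ket i S = 0.
Proof.
move=> fixS; rewrite /F_ket big1 // => j /negP; case.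
by apply/negP/fixS; rewrite /nth_row mem_nth.
Qed.

Definition avoids (i : int) (S : symbol) : Prop :=
  forall b, b \in S -> ~~ row_mem b i && ~~ row_mem b (i + 1).

(** On w the generator F_i vanishes and K_i acts as 1, since no row contains i or i + 1. *)
Lemma F_tensl i u w : supported (avoids i) w -> F i (tens u w) = tens (F i u) w.
Proof.
move=> avw; rewrite [w]sum_ketE !tens_sumr F_sum.
apply: eq_big_seq => T Tw.
rewrite !tensZr FZ; congr (_ *: _).
rewrite [u]sum_ketE [X in F i X]tens_suml [LHS]F_sum F_sum tens_suml; apply: eq_bigr => S _.
rewrite tensZl [LHS]FZ FZ tensZl F_tens_ket; congr (_ *: _).
rewrite [F i (ket T)]F_ketE F_ket_eq0 ?tens0r ?addr0; last first.
  by move=> b /(avw T Tw)/andP[/negPf bi _]; rewrite /movable bi.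
have cnt0 i' : (forall b, b \in T -> ~~ row_mem b i') ->
    count (fun b => row_mem b i') T = 0%N.
  by move=> niT; apply/eqP; rewrite eqn0Ngt -has_count; apply/hasPn.
rewrite /below_exponent !cnt0 ?scale1r //.
  by move=> b /(avw T Tw)/andP[].
by move=> b /(avw T Tw)/andP[].
Qed.

Definition fixed_rows (i : int) (S : symbol) : Prop :=
  forall b, b \in S -> ~~ movable b i.

(** The term of the coproduct in which F_i acts on u vanishes; no condition on w arises, because the
    other term carries no power of q. *)
Lemma F_tensr i u w : supported (fixed_rows i) u -> F i (tens u w) = tens u (F i w).
Proof.
move=> fixu; rewrite [u]sum_ketE !tens_suml F_sum.
apply: eq_big_seq => S Su.
rewrite !tensZl FZ; congr (_ *: _).
rewrite [w]sum_ketE [X in F i X]tens_sumr [LHS]F_sum F_sum tens_sumr; apply: eq_bigr => T _.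
rewrite tensZr [LHS]FZ FZ tensZr F_tens_ket; congr (_ *: _).
by rewrite [F i (ket S)]F_ketE F_ket_eq0 ?tens0l ?scaler0 ?add0r //; apply: fixu.
Qed.

(** Divided powers are scalar multiples of iterates, and the runs of s only involve values of s. *)
Lemma F_seq_comm (h : Fock -> Fock) s u :
  (forall c w, h (c *: w) = c *: h w) ->
  (forall i w, i \in s -> F i (h w) = h (F i w)) ->
  F_seq s (h u) = h (F_seq s u).
Proof.
move=> hZ hF; rewrite /F_seq.
have {hF}: forall p, p \in runs s -> forall w, F p.1 (h w) = h (F p.1 w).
  suff sub : forall p, p \in runs s -> p.1 \in s by move=> p /sub ps w; apply: hF.
  elim: s {hF} => //= i s IH p; case: (runs s) IH => [|[i' b] t] IH.
    by rewrite inE => /eqP ->; rewrite mem_head.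
  case: eqP => [->|_]; rewrite !inE.
    case/orP => [/eqP ->|pt]; rewrite ?eqxx //.
    by rewrite IH ?orbT // inE pt orbT.
  case/orP => [/eqP ->|pt]; first by rewrite eqxx.
  by rewrite IH ?orbT // inE.
elim: (runs s) => //= -[i b] t IH hF; rewrite IH => [|p pt]; last first.
  by apply: hF; rewrite inE pt orbT.
rewrite /F_div hZ; congr (_ *: _) => /=.
have {}hF w : F i (h w) = h (F i w) by apply: (hF (i, b)); rewrite mem_head.
elim: b {IH} => //= b IH; by rewrite IH hF.
Qed.

Lemma F_seq_tensl s u w :
  (forall i, i \in s -> supported (avoids i) w) -> F_seq s (tens u w) = tens (F_seq s u) w.
Proof.
move=> avw; apply: (F_seq_comm (h := tensr w)) => [c u'|i u' si].
  exact: tensZl.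
by apply: F_tensl; apply: avw.
Qed.

Lemma F_seq_tensr s u w :
  (forall i, i \in s -> supported (fixed_rows i) u) ->
  F_seq s (tens u w) = tens u (F_seq s w).
Proof.
move=> fixu; apply: (F_seq_comm (h := tens u)) => [c w'|i w' si].
  exact: tensZr.
by apply: F_tensr; apply: fixu.
Qed.

(** The scalar that relates the product of divided powers to the plain product of the F_i. *)
Definition runs_factor (s : seq int) : Qq := \prod_(p <- runs s) (qfact p.2)^-1.

Lemma F_seqE s u : F_seq s u = runs_factor s *: foldr F u s.
Proof.
have foldrE : foldr F u s = foldr (fun p w => iter p.2 (F p.1) w) u (runs s).
  elim: s => //= i s ->; case: (runs s) => [|[i' b] t] //=.
  by case: eqP => [->|].
rewrite foldrE /F_seq /runs_factor; elim: (runs s) => [|[i b] t IH] /=.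
  by rewrite big_nil scale1r.
rewrite IH big_cons /F_div -scalerA; congr (_ *: _).
by elim: b => [//|b IHb]; rewrite !iterS IHb; apply: FZ.
Qed.

(** No maximal run straddles the junction, since the last value of s does not occur in t. *)
Lemma runs_cat s t : (forall i, i \in s -> i \notin t) ->
  runs (s ++ t) = runs s ++ runs t.
Proof.
elim: s => //= i s IH nst; rewrite IH; last first.
  by move=> j js; apply: nst; rewrite inE js orbT.
have: i \notin t by apply: nst; rewrite mem_head.
case: (runs s) => [|[i' b] u] //=; last by case: ifP.
case: t {IH nst} => //= j t; rewrite inE negb_or => /andP[/negPf nij _].
by case: (runs t) => [|[j' c] u]; last case: (j == j'); rewrite nij.
Qed.

Lemma F_seq_cat s t u : (forall i, i \in s -> i \notin t) ->
  F_seq (s ++ t) u = F_seq s (F_seq t u).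
Proof. by move=> nst; rewrite /F_seq runs_cat // foldr_cat. Qed.

(** * Entries reachable by a bounded number of moves *)

(** Satisfied by every row obtained from a vacuum row by at most m moves: the entry in position k,
    counted from the largest, can only move after the k larger ones have moved. *)
Definition row_bound (m : nat) (b : Defs.row) : Prop :=
  forall k : nat, entry b k <= charge b - k%:Z + m%:Z /\
    ((m <= k)%N -> entry b k = charge b - k%:Z).

Lemma row_bound_le m b i : row_bound m b -> row_mem b i -> i <= charge b + m%:Z.
Proof. by move=> bm /asboolP[k <-]; have [le _] := bm k; lia. Qed.

Lemma entry_ge b k : charge b - k%:Z <= entry b k.
Proof.
have [N HN] := entry_eventually b.
have [p] := ubnP (N - k)%N; elim: p k => // p IH k lt_p.
case: (leqP N k) => [/HN->//|lt_k].
have := IH k.+1 ltac:(lia); have := entry_decr b k; lia.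
Qed.

Lemma movable_bound m b i : row_bound m b -> movable b i ->
  charge b - m%:Z <= i <= charge b + m%:Z.
Proof.
move=> bm /andP[bi ni]; rewrite (row_bound_le bm bi) andbT.
case/asboolP: bi => k ek; have ge := entry_ge b k.
have [le_k|lt_k] := leqP k m; first by lia.
(* Below position m the row is still the vacuum, so the preceding entry is i + 1 and blocks i. *)
case/negP: ni; apply/asboolP; exists k.-1.
have [_ e1] := bm k; have [_ e2] := bm k.-1; rewrite -ek e1 ?e2; lia.
Qed.

Lemma raise_row_bound m b i : row_bound m b -> row_bound m.+1 (raise_row b i).
Proof.
move=> bm k /=; rewrite /raise_entry; have [le eq] := bm k.
case: ifP => [/andP[mov /eqP ek]|_]; last by split=> [|lt]; [lia|apply: eq; lia].
split=> [|lt]; first by lia.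
(* A moved entry in a position k > m would have i + 1 just before it, in its vacuum place. *)
case/andP: mov => _ /negP; case; apply/asboolP; exists k.-1.
have [_ e2] := bm k.-1; rewrite -ek eq ?e2; lia.
Qed.

Lemma row_boundS m b : row_bound m b -> row_bound m.+1 b.
Proof. by move=> bm k; have [le eq] := bm k; split=> [|lt]; [lia|apply: eq; lia]. Qed.

Lemma row_bound_empty c : row_bound 0 (empty_row c).
Proof. by move=> k /=; split=> //; lia. Qed.

Definition symbol_bound (v : seq int) (m : nat) (S : symbol) : Prop :=
  multicharge S = v /\ forall b, b \in S -> row_bound m b.

Lemma vac_bound v : supported (symbol_bound v 0) (vac v).
Proof.
apply: supported_ket; split; first by rewrite /multicharge -map_comp map_id.
by move=> b /mapP[c _ ->]; apply: row_bound_empty.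
Qed.

Lemma F_ket_bound v m i S : symbol_bound v m S ->
  supported (symbol_bound v m.+1) (F_ket i S).
Proof.
case=> vS bS; rewrite /F_ket; apply: supported_sum => j _ _.
apply: supportedZ; apply: supported_ket; split.
  have sz : size (set_nth (empty_row 0) S j (raise_row (nth_row S j) i)) = size S.
    by rewrite size_set_nth (maxn_idPr _).
  rewrite -vS /multicharge; apply: (@eq_from_nth _ 0) => [|k]; rewrite !size_map sz //.
  move=> lt_k; rewrite !(nth_map (empty_row 0)) ?sz // nth_set_nth /=.
  by case: eqP => // ->.
move=> b /(nthP (empty_row 0))[k]; rewrite size_set_nth (maxn_idPr _) // => lt_k <-.
rewrite nth_set_nth /=; case: eqP => _.
  by apply/raise_row_bound/bS/mem_nth.
by apply/row_boundS/bS/mem_nth.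
Qed.

Lemma foldr_F_bound v s :
  supported (symbol_bound v (size s)) (foldr F (vac v) s).
Proof.
elim: s => [|i s IH] /=; first exact: vac_bound.
by apply: F_supported IH => S; apply: F_ket_bound.
Qed.

Lemma F_seq_bound v s : supported (symbol_bound v (size s)) (F_seq s (vac v)).
Proof. by rewrite F_seqE; apply: supportedZ; apply: foldr_F_bound. Qed.

(** Each value must be movable in some row present when it acts, and fewer than [size s] moves
    precede it; hence the strict inequalities. *)
Lemma F_seq_range v s : F_seq s (vac v) <> 0 -> forall i, i \in s ->
  exists c c', [/\ c \in v, c' \in v & c - (size s)%:Z < i < c' + (size s)%:Z].
Proof.
rewrite F_seqE => nz.
have {nz}: foldr F (vac v) s <> 0 by move=> e; apply: nz; rewrite e scaler0.
elim: s => //= i s IH nz j; rewrite inE.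
have nz' : foldr F (vac v) s <> 0 by move=> e; apply: nz; rewrite e F0.
case/orP => [/eqP ->|/(IH nz')[c [c' [cv cv' bnd]]]]; last first.
  by exists c, c'; split=> //; lia.
have [S Ss [b bS mov]] : exists2 S, S \in msupp (foldr F (vac v) s) &
    exists2 b, b \in S & movable b i.
  apply: contrapT => no; apply: nz; rewrite /F big1_seq // => S /andP[_ Ss].
  rewrite F_ket_eq0 ?scaler0 // => b bS; apply/negP => mov.
  by apply: no; exists S => //; exists b.
have [vS /(_ b bS) bb] := foldr_F_bound Ss.
have cv : charge b \in v by rewrite -vS map_f.
by exists (charge b), (charge b); split=> //; have := movable_bound bb mov; lia.
Qed.

(** * The bar involution of Q(q) *)

Lemma fracE (R : idomainType) (x : {fraction R}) :
  x = FracField.tofrac (frac (repr x)).1 / FracField.tofrac (frac (repr x)).2.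
Proof.
have := denom_ratioP (repr x); rewrite -{2}[x]reprK -{2}(Ratio_numden (repr x)).
move: (frac (repr x)).1 (frac (repr x)).2 => n d d0.
apply: (canRL (mulfK _)); first by rewrite tofrac_eq0.
rewrite -[_ * _]/(FracField.mul _ _); unlock FracField.tofrac.
rewrite !piE /FracField.mulf /=; apply/eqP.
rewrite FracField.equivf_def !numden_Ratio ?mulf_neq0 ?oner_eq0 //.
by rewrite !mulr1 mulrC.
Qed.

HB.instance Definition _ := GRing.RMorphism.copy frac_of (@FracField.tofrac {poly rat}).

Lemma frac_of_eq0 p : (frac_of p == 0) = (p == 0).
Proof. exact: tofrac_eq0. Qed.

Lemma frac_of_inj : injective frac_of.
Proof. by move=> a b /eqP; rewrite tofrac_eq => /eqP. Qed.

Definition ratC (c : rat) : Qq := frac_of c%:P.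

HB.instance Definition _ := GRing.RMorphism.copy ratC (frac_of \o polyC).

Lemma eval_qinvE p : eval_qinv p = horner_eval q^-1 (map_poly ratC p).
Proof. by []. Qed.

Lemma eval_qinv_is_zmod_morphism : zmod_morphism eval_qinv.
Proof. by move=> a b; rewrite !eval_qinvE !rmorphB. Qed.

Lemma eval_qinv_is_monoid_morphism : monoid_morphism eval_qinv.
Proof. by split=> [|a b]; rewrite !eval_qinvE ?rmorph1 // !rmorphM. Qed.

HB.instance Definition _ := GRing.isZmodMorphism.Build {poly rat} Qq eval_qinv
  eval_qinv_is_zmod_morphism.
HB.instance Definition _ := GRing.isMonoidMorphism.Build {poly rat} Qq eval_qinv
  eval_qinv_is_monoid_morphism.

Lemma eval_qinvX : eval_qinv 'X = q^-1.
Proof. by rewrite eval_qinvE map_polyX /horner_eval hornerX. Qed.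

(** Substituting 1/q and clearing denominators reverses the coefficients. *)
Lemma eval_qinv_rev (p : {poly rat}) N : (size p <= N.+1)%N ->
  q ^+ N * eval_qinv p = frac_of (\poly_(i < N.+1) p`_(N - i)).
Proof.
move=> szp; rewrite eval_qinvE /horner_eval (@horner_coef_wide _ N.+1); last first.
  by rewrite size_map_poly.
rewrite poly_def rmorph_sum mulr_sumr (reindex_inj rev_ord_inj) /=.
apply: eq_bigr => i _; rewrite subSS coef_map /= -mul_polyC rmorphM rmorphXn mulrCA.
congr (_ * _); have le_i : (i <= N)%N by rewrite -ltnS.
by rewrite -{1}(subnK le_i) exprD exprVn mulrAC divff ?mul1r // expf_neq0 // q_neq0.
Qed.

Lemma eval_qinv_eq0 (p : {poly rat}) : (eval_qinv p == 0) = (p == 0).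
Proof.
apply/eqP/eqP => [e|->]; last exact: rmorph0.
(* With N = [size p], every coefficient of p reappears in the reversed polynomial, which is zero. *)
have /esym/eqP := @eval_qinv_rev p (size p) (leqnSn _).
rewrite e mulr0 frac_of_eq0 => /eqP pe; apply/polyP => i; rewrite coef0.
have [le|lt] := leqP (size p) i; first by rewrite nth_default.
have := congr1 (fun r : {poly rat} => r`_(size p - i)) pe.
by rewrite coef_poly coef0 ltnS leq_subr subKn // ltnW.
Qed.

(** Equality of fractions is a cross-multiplication identity, which the ring morphism [eval_qinv]
    preserves; so any representing fraction may be used. *)
Lemma qbar_frac a b : b != 0 ->
  qbar (frac_of a / frac_of b) = eval_qinv a / eval_qinv b.
Proof.
move=> b0; set x := _ / _; rewrite /qbar.
have d0 := denom_ratioP (repr x).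
have := fracE x; move: (frac (repr x)).1 (frac (repr x)).2 d0 => n d d0 e.
have {e} : n * b = a * d.
  apply: frac_of_inj; rewrite !rmorphM.
  by apply/eqP; rewrite -eqr_div ?frac_of_eq0 // -[frac_of n / _]e.
move/(congr1 eval_qinv); rewrite !rmorphM => e.
by apply/eqP; rewrite eqr_div ?eval_qinv_eq0 // e.
Qed.

Lemma Qq_ind (P : Qq -> Prop) :
  (forall a b, b != 0 -> P (frac_of a / frac_of b)) -> forall x, P x.
Proof. by move=> Pf x; rewrite [x]fracE; apply/Pf/denom_ratioP. Qed.

Lemma qbar_is_zmod_morphism : zmod_morphism qbar.
Proof.
elim/Qq_ind => a b b0; elim/Qq_ind => c d d0.
rewrite -mulNr addf_div ?frac_of_eq0 // !qbar_frac // -mulNr addf_div ?eval_qinv_eq0 //.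
by rewrite -!rmorphN -!rmorphM -!rmorphD qbar_frac ?mulf_neq0.
Qed.

Lemma qbar_is_monoid_morphism : monoid_morphism qbar.
Proof.
split; first by rewrite -[1]divr1 -(rmorph1 frac_of) qbar_frac ?oner_eq0 // !rmorph1 divr1.
elim/Qq_ind => a b b0; elim/Qq_ind => c d d0.
rewrite mulf_div !qbar_frac // mulf_div -!rmorphM.
by rewrite qbar_frac ?mulf_neq0.
Qed.

HB.instance Definition _ := GRing.isZmodMorphism.Build Qq Qq qbar qbar_is_zmod_morphism.
HB.instance Definition _ := GRing.isMonoidMorphism.Build Qq Qq qbar
  qbar_is_monoid_morphism.

Lemma qbar_q : qbar q = q^-1.
Proof.
have {1}-> : q = frac_of 'X / frac_of 1 by rewrite rmorph1 divr1.
by rewrite qbar_frac ?oner_eq0 // eval_qinvX rmorph1 divr1.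
Qed.

Lemma qbar_qint a : qbar (qint a) = qint a.
Proof.
rewrite /qint fmorph_div !rmorphB !fmorphV !rmorphXn /= qbar_q.
(* Numerator and denominator both change sign. *)
by rewrite exprVn !invrK -opprB -[q^-1 - q]opprB invrN mulrNN.
Qed.

Lemma qbar_runs_factor s : qbar (runs_factor s) = runs_factor s.
Proof.
rewrite rmorph_prod; apply: eq_bigr => p _; rewrite fmorphV rmorph_prod.
by congr (_^-1); apply: eq_bigr => c _; apply: qbar_qint.
Qed.

(** * Uniqueness of the canonical basis *)

Local Notation span := Defs.span.

Lemma span_gen A X c x : A c -> X x -> span A X (c *: x).
Proof.
move=> Ac Xx; exists 1%N, (fun=> c), (fun=> x); split=> //.
by rewrite big_ord1.
Qed.

Lemma span0 A X : span A X 0.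
Proof. by exists 0%N, (fun=> 0), (fun=> 0); split=> [[]|]; rewrite ?big_ord0. Qed.

Lemma spanD A X u w : span A X u -> span A X w -> span A X (u + w).
Proof.
move=> [m [c [x [cx ->]]]] [p [d [y [dy ->]]]].
exists (m + p)%N, (fun i => match split i with inl j => c j | inr j => d j end),
  (fun i => match split i with inl j => x j | inr j => y j end); split.
  by move=> i; case: (split i).
rewrite big_split_ord; apply: (f_equal2 (fun u w : Fock => u + w)).
  by apply: eq_bigr => i _; rewrite (unsplitK (inl i)).
by apply: eq_bigr => i _; rewrite (unsplitK (inr i)).
Qed.

Lemma span_sum A X (I : eqType) (s : seq I) (f : I -> Fock) :
  (forall i, i \in s -> span A X (f i)) -> span A X (\sum_(i <- s) f i).
Proof.
elim: s => [|i s IH] fs; first by rewrite big_nil; apply: span0.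
rewrite big_cons; apply: spanD; first by apply: fs; rewrite mem_head.
by apply: IH => j js; apply: fs; rewrite inE js orbT.
Qed.

Lemma span_ind A X (P : Fock -> Prop) :
  P 0 -> (forall u w, P u -> P w -> P (u + w)) ->
  (forall c x, A c -> X x -> P (c *: x)) -> forall u, span A X u -> P u.
Proof.
move=> P0 PD PZ u [m [c [x [cx ->]]]].
by elim/big_rec: _ => // i w _ Pw; apply: PD => //; have [] := cx i; apply: PZ.
Qed.

(** Several terms may come from one symbol; their coefficients are added, which is why A has to be
    closed under sums. *)
Lemma span_imageE A (D : set symbol) (x : symbol -> Fock) u :
  A 0 -> (forall c d, A c -> A d -> A (c + d)) -> span A (x @` D) u ->
  exists s c, [/\ uniq s, forall S, S \in s -> D S /\ A (c S) &
    u = \sum_(S <- s) c S *: x S].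
Proof.
move=> A0 AD [m [c [y [cy ->]]]].
have /fin_all_exists[T T_cond] : forall i, exists S, D S /\ x S = y i.
  by move=> i; have [_ [S DS xS]] := cy i; exists S.
exists (undup (codom T)), (fun S => \sum_(i | T i == S) c i); split.
- exact: undup_uniq.
- move=> S; rewrite mem_undup => /codomP[i ->]; split; first by have [] := T_cond i.
  elim/big_rec: _ => // j d _ Ad; apply: AD => //; by have [] := cy j.
under eq_bigr do rewrite -(proj2 (T_cond _)).
transitivity (\sum_(S <- undup (codom T)) \sum_(i | T i == S) c i *: x (T i)); last first.
  apply: eq_bigr => S _; rewrite scaler_suml; apply: eq_bigr => i /eqP ->; exact: erefl.
rewrite (exchange_big_dep xpredT) //=; apply: eq_bigr => i _.
rewrite -big_filter (_ : [seq _ <- _ | _] = [:: T i]) ?big_seq1 //.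
rewrite (eq_filter (a2 := pred1 (T i))); last by move=> S; rewrite /= eq_sym.
by rewrite filter_pred1_uniq ?undup_uniq // mem_undup codom_f.
Qed.

(** * Functions regular at 0 and integral Laurent polynomials *)

Lemma regular_at0_frac p : regular_at0 (frac_of p).
Proof. by exists p, 1; rewrite hornerC oner_eq0 rmorph1 divr1. Qed.

Lemma frac_of_horner0_neq0 p : p.[0] != 0 -> frac_of p != 0.
Proof. by rewrite frac_of_eq0; apply: contraNneq => ->; rewrite horner0. Qed.

Lemma regular_at0D f g : regular_at0 f -> regular_at0 g -> regular_at0 (f + g).
Proof.
move=> [a [b [b0 ->]]] [c [d [d0 ->]]]; exists (a * d + c * b), (b * d).
rewrite hornerM mulf_neq0 // addf_div ?frac_of_horner0_neq0 //.
by rewrite rmorphD !rmorphM.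
Qed.

Lemma regular_at0M f g : regular_at0 f -> regular_at0 g -> regular_at0 (f * g).
Proof.
move=> [a [b [b0 ->]]] [c [d [d0 ->]]]; exists (a * c), (b * d).
by rewrite hornerM mulf_neq0 // mulf_div !rmorphM.
Qed.

Lemma regular_at0_0 : regular_at0 0.
Proof. by rewrite -(rmorph0 frac_of); apply: regular_at0_frac. Qed.

Lemma regular_at0_1 : regular_at0 1.
Proof. by rewrite -(rmorph1 frac_of); apply: regular_at0_frac. Qed.

Lemma regular_at0N f : regular_at0 f -> regular_at0 (- f).
Proof.
move=> f0; rewrite -mulN1r -(rmorph1 frac_of) -rmorphN.
by apply: regular_at0M => //; apply: regular_at0_frac.
Qed.

Lemma regular_at0_qX m : regular_at0 (q ^+ m).
Proof. by rewrite -rmorphXn; apply: regular_at0_frac. Qed.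

Lemma regular_at0_sum (I : eqType) (s : seq I) (f : I -> Qq) :
  (forall i, i \in s -> regular_at0 (f i)) -> regular_at0 (\sum_(i <- s) f i).
Proof.
move=> fs; rewrite big_seq; elim/big_rec: _ => [|i g /fs]; first exact: regular_at0_0.
exact: regular_at0D.
Qed.

HB.instance Definition _ := GRing.RMorphism.copy polyZ
  (frac_of \o map_poly (fun c : int => c%:~R : rat)).

Lemma laurentZ0 : laurentZ 0.
Proof. by exists 0, 0%N; rewrite rmorph0 mul0r. Qed.

Lemma laurentZ1 : laurentZ 1.
Proof. by exists 1, 0%N; rewrite rmorph1 divr1. Qed.

Lemma polyZX : polyZ 'X = q.
Proof. by rewrite /polyZ map_polyX. Qed.

Lemma laurentZD f g : laurentZ f -> laurentZ g -> laurentZ (f + g).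
Proof.
move=> [p [m ->]] [p' [m' ->]]; exists (p * 'X^m' + p' * 'X^m), (m + m')%N.
rewrite rmorphD !rmorphM !rmorphXn /= polyZX exprD addf_div //.
  by rewrite expf_neq0 // q_neq0.
by rewrite expf_neq0 // q_neq0.
Qed.

Lemma laurentZM f g : laurentZ f -> laurentZ g -> laurentZ (f * g).
Proof.
move=> [p [m ->]] [p' [m' ->]]; exists (p * p'), (m + m')%N.
by rewrite rmorphM exprD mulf_div.
Qed.

Lemma laurentZN f : laurentZ f -> laurentZ (- f).
Proof. by move=> [p [m ->]]; exists (- p), m; rewrite rmorphN mulNr. Qed.

(* In [q p(q) = q^-1 p(q^-1)] the two sides only involve positive, respectively
   negative, powers of q. *)
Lemma laurent_bar_eq0 d r : laurentZ d -> qbar d = d -> regular_at0 r ->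
  d = q * r -> d = 0.
Proof.
move=> [p [m dE]] bar_d [a [b [b0 ->]]] dqr.
set P := map_poly (fun c : int => c%:~R : rat) p.
have qm0 : q ^+ m != 0 by rewrite expf_neq0 // q_neq0.
have fb0 : frac_of b != 0 by apply: frac_of_horner0_neq0.
have PE : P * b = 'X^(m.+1) * a.
  apply: frac_of_inj; rewrite !rmorphM rmorphXn /=.
  have : frac_of P / q ^+ m = q * (frac_of a / frac_of b) by rewrite -dqr dE.
  rewrite mulrA => /eqP; rewrite (eqr_div _ _ qm0 fb0) => /eqP ->.
  by rewrite exprS mulrAC.
(* Since b(0) is nonzero, b is coprime to X, and the power of X dividing P * b divides P. *)
have /dvdpP[P' P'E] : 'X^(m.+1) %| P.
  rewrite -(@Gauss_dvdpl _ _ b); first by rewrite PE dvdp_mulr.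
  rewrite coprimep_expl // -['X]subr0 -polyC0 coprimep_sym coprimep_XsubC.
  by rewrite rootE.
have {}dE : d = frac_of ('X * P').
  rewrite dE /polyZ -/P P'E exprS mulrA rmorphM rmorphXn /= (mulfK qm0).
  by rewrite mulrC.
suff P0 : P' = 0 by rewrite dE P0 mulr0 rmorph0.
have := eval_qinv_rev (leqnSn (size P')).
set N := size P' => revE.
(* Both sides are q^(N+1) d, the right one computed from bar d. It has size at most N + 1, whereas
   the left one has size 2N + 2 unless P' = 0. *)
have : frac_of ('X^(N.+1) * P') * q = frac_of (\poly_(i < N.+1) P'`_(N - i)).
  rewrite -revE -[X in X = _]mulrC.
  have -> : q * frac_of ('X^(N.+1) * P') = q ^+ N * (q * d).
    by rewrite dE !rmorphM rmorphXn /= exprS; ring.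
  congr (_ * _); rewrite -{1}bar_d dE -[frac_of ('X * _)]divr1 -(rmorph1 frac_of).
  rewrite qbar_frac ?oner_eq0 // !rmorph1 divr1.
  by rewrite rmorphM /= eval_qinvX; apply: (mulVKf q_neq0).
rewrite -[X in _ * X]/(frac_of 'X) -rmorphM => /frac_of_inj.
move/(congr1 (fun r : {poly rat} => size r)).
move=> sz; apply/eqP; rewrite -size_poly_eq0 -/N; apply/negPn/negP => N0.
have P'0 : P' != 0 by rewrite -size_poly_eq0.
have := size_poly N.+1 (fun i => P'`_(N - i)).
rewrite -sz size_mulX ?size_monicM ?size_polyXn ?monicXn //; last first.
  by rewrite mulf_neq0 // monic_neq0 ?monicXn.
by rewrite -/N; lia.
Qed.

Lemma mcoeff_sum (I : Type) (s : seq I) (P : pred I) (f : I -> Fock) T :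
  mcoeff T (\sum_(i <- s | P i) f i) = \sum_(i <- s | P i) mcoeff T (f i).
Proof. exact: (big_morph _ (mcoeffD T) (mcoeff0 _)). Qed.

Lemma F_R_regular v w T : F_R v w -> regular_at0 (mcoeff T w).
Proof.
move: w; apply: span_ind => [|u u' ? ?|c _ rc [S _ <-]].
- by rewrite mcoeff0; apply: regular_at0_0.
- by rewrite mcoeffD; apply: regular_at0D.
rewrite mcoeffZ mcoeff_ket; apply: regular_at0M => //.
by case: (S == T); [apply: regular_at0_1|apply: regular_at0_0].
Qed.

(** * The module generated by the vacuum and its bar involution *)

Lemma V_foldr v c s : V v (c *: foldr F (vac v) s).
Proof. by apply: span_gen => //; exists s. Qed.

Lemma VZ v c u : V v u -> V v (c *: u).
Proof.
move: u; apply: span_ind => [|u w|d _ _ [s ->]].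
- by rewrite scaler0; apply: span0.
- by rewrite scalerDr; apply: spanD.
by rewrite scalerA; apply: V_foldr.
Qed.

Lemma V_Z_sub v u : V_Z v u -> V v u.
Proof.
move: u; apply: span_ind => [|u w|d _ _ [s ->]].
- exact: span0.
- exact: spanD.
by rewrite F_seqE scalerA; apply: V_foldr.
Qed.

(** Semilinearity is only available on A, so all partial sums have to be kept in A. *)
Lemma semilinear_sum (K : fieldType) (W : lmodType K) (A : set W)
    (sigma : {rmorphism K -> K}) (psi : W -> W) (I : eqType) (s : seq I)
    (c : I -> K) (x : I -> W) :
  A 0 -> (forall u w, A u -> A w -> A (u + w)) -> (forall a u, A u -> A (a *: u)) ->
  (forall u w, A u -> A w -> psi (u + w) = psi u + psi w) ->
  (forall a u, A u -> psi (a *: u) = sigma a *: psi u) ->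
  (forall i, i \in s -> A (x i)) ->
  psi (\sum_(i <- s) c i *: x i) = \sum_(i <- s) sigma (c i) *: psi (x i).
Proof.
move=> A0 AD AZ psiD psiZ; elim: s => [|i s IH] Ax.
  (* That psi fixes 0 follows from semilinearity with the scalar 0. *)
  by rewrite !big_nil -(scale0r (0 : W)) psiZ // rmorph0 !scale0r.
have Ai : A (x i) by apply: Ax; rewrite mem_head.
have As j : j \in s -> A (x j) by move=> js; apply: Ax; rewrite inE js orbT.
rewrite !big_cons psiD ?psiZ ?IH //; first exact: AZ.
rewrite big_seq; elim/big_rec: _ => // j u /As Aj; exact/AD/AZ.
Qed.

Lemma sumB_eq0 (W : zmodType) (I : Type) (s : seq I) (f g : I -> W) :
  \sum_(i <- s) f i = \sum_(i <- s) g i -> \sum_(i <- s) (f i - g i) = 0.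
Proof. by move=> fg; rewrite sumrB fg subrr. Qed.

(** Here e is one coordinate of basis vectors that are unitriangular modulo t; it isolates [d i],
    all other terms being multiples of t. *)
Lemma unitriangular_coef (K : fieldType) (I : eqType) (s : seq I) (d e y : I -> K)
    (t a b : K) (i : I) : uniq s -> i \in s ->
  (forall j, j \in s -> e j = (j == i)%:R + t * y j) ->
  \sum_(j <- s) d j * e j = t * a - t * b ->
  d i = t * (a - b - \sum_(j <- s) d j * y j).
Proof.
move=> us si eE; rewrite (eq_big_seq (fun j => d j * (j == i)%:R + t * (d j * y j))).
  rewrite big_split /= -mulr_sumr (bigD1_seq i) //= eqxx mulr1 big1 ?addr0.
    by move/(canRL (addrK _)) => ->; rewrite !mulrBr.
  by move=> j /negPf ->; rewrite mulr0.
by move=> j js; rewrite eE // mulrDr mulrCA.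
Qed.

Section BarInvolution.
Variables (v : seq int) (psi : Fock -> Fock).
Hypothesis psiP : is_bar_involution v psi.

Lemma bar_foldr s : psi (foldr F (vac v) s) = foldr F (vac v) s.
Proof.
have [_ _ _ psiF psi0] := psiP; elim: s => //= i s IH; rewrite psiF ?IH //.
by rewrite -[foldr _ _ _]scale1r; apply: V_foldr.
Qed.

Lemma bar_F_seq s : psi (F_seq s (vac v)) = F_seq s (vac v).
Proof.
have [_ _ psiZ _ _] := psiP; rewrite F_seqE psiZ; last first.
  by rewrite -[foldr _ _ _]scale1r; apply: V_foldr.
by rewrite qbar_runs_factor bar_foldr.
Qed.

Lemma bar_sum (I : eqType) (s : seq I) (c : I -> Qq) (x : I -> Fock) :
  (forall i, i \in s -> V v (x i)) ->
  psi (\sum_(i <- s) c i *: x i) = \sum_(i <- s) qbar (c i) *: psi (x i).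
Proof.
have [_ psiD psiZ _ _] := psiP => Vx.
apply: (semilinear_sum (A := V v) (sigma := qbar)) => //.
- exact: span0.
- exact: spanD.
- exact: VZ.
Qed.

Lemma bar_sum_fixed (I : eqType) (s : seq I) (c : I -> Qq) (x : I -> Fock) :
  (forall i, i \in s -> [/\ V v (x i), psi (x i) = x i & qbar (c i) = c i]) ->
  psi (\sum_(i <- s) c i *: x i) = \sum_(i <- s) c i *: x i.
Proof.
move=> fx; rewrite bar_sum => [|i /fx[] //].
apply: eq_big_seq => i /fx[_ xi ci]; exact: (f_equal2 (fun a u => a *: u) ci xi).
Qed.

Lemma barB u w : V v u -> V v w -> psi (u - w) = psi u - psi w.
Proof.
have [_ psiD psiZ _ _] := psiP => Vu Vw.
rewrite -[- w]scaleN1r (psiD _ _ Vu (VZ _ Vw)) (psiZ _ _ Vw).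
by rewrite rmorphN rmorph1 scaleN1r.
Qed.
End BarInvolution.

Lemma canonical_basis_unique v G S X :
  is_canonical_basis v G -> standard_symbols v S -> V_Z v X ->
  (forall psi, is_bar_involution v psi -> psi X = X) ->
  (exists2 w, F_R v w & X - ket S = q *: w) -> G S = X.
Proof.
move=> [[VG freeG] [VZG _] [psi psiP psiG] GR] DS VZX /(_ psi psiP) psiX [w Rw Xw].
have VG' T : standard_symbols v T -> V v (G T).
  by move=> DT; rewrite -VG -[G T]scale1r; apply: span_gen => //; exists T.
(* Expanding in the basis of the integral form makes the coordinates Laurent polynomials rather than
   arbitrary rational functions. *)
have : span laurentZ (G @` standard_symbols v) (X - G S).
  apply: spanD; first by rewrite VZG.
  rewrite -scaleN1r; apply: span_gen; last by exists S.
  exact/laurentZN/laurentZ1.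
case/(span_imageE laurentZ0 laurentZD) => s [d [us dP XE]].
have psiXG : psi (X - G S) = X - G S.
  by rewrite (barB psiP (V_Z_sub VZX) (VG' S DS)) psiX psiG.
(* The vector and its image under psi have coordinates d and [qbar] of d, which agree by linear
   independence over Q(q). *)
have bar_d T : T \in s -> qbar (d T) = d T.
  move: psiXG; rewrite XE (bar_sum psiP) => [|U /dP[/VG']//].
  move=> barXE Ts; apply/eqP; rewrite -subr_eq0; apply/eqP.
  apply: (freeG s (fun T => qbar (d T) - d T) us) Ts => [U /dP[DU _]|]; first by split.
  under eq_bigr do rewrite scalerBl.
  apply: sumB_eq0; rewrite -[RHS]barXE; apply: eq_big_seq => U /dP[DU _].
  exact: (congr1 (fun x => qbar (d U) *: x) (esym (psiG U DU))).
(* The remainders in G(T) = T + q y(T); the value 0 at nonstandard symbols is a dummy. *)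
have /choice[y yP] : forall T, exists y, standard_symbols v T ->
    F_R v y /\ G T - ket T = q *: y.
  move=> T; case: (pselect (standard_symbols v T)) => [DT|nD]; last by exists 0.
  by have [y] := GR T DT; exists y.
have coefG T U : standard_symbols v U ->
    mcoeff T (G U) = (U == T)%:R + q * mcoeff T (y U).
  move=> DU; rewrite -[G U](subrK (ket U)) (proj2 (yP U DU)).
  by rewrite mcoeffD mcoeffZ mcoeff_ket addrC.
have coefE T : T \in s ->
    d T = q * (mcoeff T w - mcoeff T (y S) - \sum_(U <- s) d U * mcoeff T (y U)).
  move=> Ts; have coefX : mcoeff T (X - G S) = q * mcoeff T w - q * mcoeff T (y S).
    have -> : X - G S = q *: w - q *: y S.
      by rewrite -Xw -(proj2 (yP S DS)) opprB addrA subrK.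
    by rewrite mcoeffB; congr (_ - _); apply: mcoeffZ.
  apply: (unitriangular_coef (e := fun U => mcoeff T (G U))) => //.
  - by move=> U /dP[DU _]; apply: coefG.
  rewrite -coefX XE mcoeff_sum; apply: eq_bigr => U _; exact/esym/mcoeffZ.
suff d0 T : T \in s -> d T = 0.
  apply/esym/subr0_eq; rewrite XE; apply: big1_seq => T /andP[_ Ts].
  by rewrite (d0 T Ts); apply: scale0r.
move=> Ts.
(* If q^m clears the poles at 0 of all coordinates, then [coefE] puts these multiples even in qR. *)
have descend m : (forall U, U \in s -> regular_at0 (q ^+ m * d U)) ->
    forall U, U \in s -> exists2 r, regular_at0 r & q ^+ m * d U = q * r.
  move=> reg U Us; rewrite (coefE U Us) mulrCA.
  eexists; last exact: erefl.
  rewrite mulrBr mulr_sumr; apply: regular_at0D; last first.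
    apply/regular_at0N/regular_at0_sum => U' U's; rewrite mulrA.
    apply: regular_at0M; first exact: reg.
    have [DU' _] := dP U' U's; have [Ry _] := yP U' DU'; exact: F_R_regular Ry.
  apply: regular_at0M; first exact: regular_at0_qX.
  apply: regular_at0D; first exact: F_R_regular Rw.
  by apply: regular_at0N; have [Ry _] := yP S DS; exact: F_R_regular Ry.
have reg0 U : U \in s -> regular_at0 (q ^+ 0 * d U).
  have [m] : exists m, forall U, U \in s -> regular_at0 (q ^+ m * d U).
    have /choice[e eP] : forall U, exists m, U \in s -> regular_at0 (q ^+ m * d U).
      move=> U'; case: (boolP (U' \in s)) => [/dP[_ [p [m ->]]]|]; last by exists 0%N.
      exists m => _; rewrite mulrC divfK ?expf_neq0 ?q_neq0 //.
      exact: regular_at0_frac.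
    (* A common exponent for the finitely many coordinates. *)
    exists (\max_(U' <- s) e U') => U' U's.
    rewrite -(subnK (@leq_bigmax_seq _ s xpredT e U' U's isT)) exprD -mulrA.
    by apply: regular_at0M; [apply: regular_at0_qX|apply: eP].
  (* By [descend], q^(m+1) d = q r with r regular; cancelling q shows that the exponent m already
     suffices. *)
  elim: m => [|m IH] reg; first exact: reg.
  apply: IH => U' U's; have [r rr] := descend _ reg _ U's.
  by rewrite exprS -mulrA => /(mulfI q_neq0) ->.
have [r rr] := descend 0%N reg0 T Ts; rewrite expr0 mul1r => dT.
by have [_ ld] := dP T Ts; apply: laurent_bar_eq0 ld (bar_d T Ts) rr dT.
Qed.

(** * Tensor products over a family of blocks *)

(** The index type may be infinite; the sums are transported to the finite type of elements of the
    union of the [A j], where products distribute over sums, and back. *)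
Lemma fsbig_distr (R : eqType) (zero one : R) (times : Monoid.mul_law zero)
    (plus : Monoid.add_law zero times) (r : nat) (I : choiceType)
    (A : 'I_r -> set I) (f : 'I_r -> I -> R) :
  (forall j, finite_set (A j)) ->
  \big[times/one]_(j < r) \big[plus/zero]_(i \in A j) f j i =
  \big[plus/zero]_(s \in [set s : {ffun 'I_r -> I} | forall j, A j (s j)])
     \big[times/one]_(j < r) f j (s j).
Proof.
move=> finA; pose U : {fset I} := (\bigcup_(j <- enum 'I_r) fset_set (A j))%fset.
have AU j i : A j i -> i \in U.
  move=> Ai; apply/bigfcupP; exists j; first by rewrite mem_enum.
  by rewrite in_fset_set // inE.
have sumU j : \big[plus/zero]_(i \in A j) f j i =
    \big[plus/zero]_(x : U | `[< A j (val x) >]) f j (val x).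
  rewrite [RHS]bigfs ?index_enum_uniq //; last by move=> x _; rewrite mem_index_enum.
  apply: reindex_fsbig; split=> [x /= /asboolP //|x y _ _ /val_inj //|i Ai].
  by exists [` AU j i Ai]%fset => //=; apply/asboolP.
rewrite (eq_bigr _ (fun j _ => sumU j)).
rewrite bigA_distr_big_dep.
rewrite [LHS]bigfs ?index_enum_uniq //; last by move=> x _; rewrite mem_index_enum.
pose h (g : {ffun 'I_r -> U}) : {ffun 'I_r -> I} := [ffun j => val (g j)].
rewrite (reindex_fsbig h [set` family (fun j => [pred x : U | `[< A j (val x) >]])]).
  by apply: eq_fsbigr => g _; apply: eq_bigr => j _; rewrite ffunE.
split=> [g /= /familyP gA j|g g' _ _ gg'|s sA].
- by rewrite ffunE; apply/asboolP; apply: gA.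
- apply/ffunP => j; have := congr1 (fun e : {ffun 'I_r -> I} => e j) gg'.
  by rewrite !ffunE => /val_inj.
exists [ffun j => [` AU j (s j) (sA j)]%fset]; last by apply/ffunP => j; rewrite !ffunE.
by apply/familyP => j; rewrite ffunE; apply/asboolP; apply: sA.
Qed.

Lemma bigtens_fsum (r : nat) (I : choiceType) (A : 'I_r -> set I)
    (f : 'I_r -> I -> Fock) :
  (forall j, finite_set (A j)) ->
  \big[tens/ket [::]]_(j < r) \sum_(i \in A j) f j i =
  \sum_(s \in [set s : {ffun 'I_r -> I} | forall j, A j (s j)])
     \big[tens/ket [::]]_(j < r) f j (s j).
Proof. exact: (fsbig_distr (ket [::]) addF). Qed.

Lemma bigtens_ket (I : Type) (s : seq I) (T : I -> symbol) :
  \big[tens/ket [::]]_(j <- s) ket (T j) = ket (flatten [seq T j | j <- s]).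
Proof.
elim: s => [|j s IH]; first by rewrite big_nil.
by rewrite big_cons IH tens_ket.
Qed.

Lemma bigtensZ (I : Type) (s : seq I) (c : I -> Qq) (u : I -> Fock) :
  \big[tens/ket [::]]_(j <- s) (c j *: u j) =
  (\prod_(j <- s) c j) *: \big[tens/ket [::]]_(j <- s) u j.
Proof.
elim: s => [|j s IH]; first by rewrite !big_nil scale1r.
rewrite [LHS]big_cons [X in tens _ X = _]IH [LHS]tensZl [X in _ *: X = _]tensZr scalerA.
rewrite [X in _ = X *: _]big_cons [X in _ = _ *: X]big_cons; exact: erefl.
Qed.

Lemma supported_bigtens (P : symbol -> Prop) (I : eqType) (s : seq I) (u : I -> Fock) :
  P [::] -> (forall S T, P S -> P T -> P (S ++ T)) ->
  (forall j, j \in s -> supported P (u j)) ->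
  supported P (\big[tens/ket [::]]_(j <- s) u j).
Proof.
move=> P0 PM Pu; rewrite big_seq; elim/big_rec: _ => [|j w js Pw].
  exact: supported_ket.
by apply: supported_tens Pw; [exact: PM|exact: Pu].
Qed.

Lemma vac_cat v w : vac (v ++ w) = tens (vac v) (vac w).
Proof. by rewrite tens_ket /vac /empty_symbol map_cat. Qed.

(** The sequences of the later blocks act first and pass over the first vacuum factor, whose rows
    they cannot move. The first sequence then acts on the first factor only, because the others
    avoid its values. *)
Lemma foldr_F_seq_tens (r : nat) (js : seq 'I_r) (s vb : 'I_r -> seq int) :
  pairwise (fun i j : 'I_r => (i < j)%N) js ->
  (forall i j : 'I_r, (i < j)%N -> forall x, x \in s i ->
     supported (avoids x) (F_seq (s j) (vac (vb j)))) ->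
  (forall i j : 'I_r, (i < j)%N -> forall x, x \in s j ->
     supported (fixed_rows x) (vac (vb i))) ->
  foldr (fun j w => F_seq (s j) w) (vac (flatten [seq vb j | j <- js])) js =
  \big[tens/ket [::]]_(j <- js) F_seq (s j) (vac (vb j)).
Proof.
move=> pw av fx; elim: js pw => [|j js IH] /=; first by rewrite big_nil.
case/andP=> /allP jlt pw; rewrite vac_cat big_cons -(IH pw).
have -> : forall w, foldr (fun j w => F_seq (s j) w) (tens (vac (vb j)) w) js =
    tens (vac (vb j)) (foldr (fun j w => F_seq (s j) w) w js).
  move=> w; elim: js jlt {IH pw} => //= i js IH jlt; rewrite IH; last first.
    by move=> i' ijs; apply: jlt; rewrite inE ijs orbT.
  by apply: F_seq_tensr => x; apply: fx; apply: jlt; rewrite mem_head.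
rewrite (IH pw); apply: F_seq_tensl => x xs; apply: supported_bigtens => //.
  by move=> S T avS avT b; rewrite mem_cat => /orP[/avS|/avT].
by move=> i ijs; apply: av xs; apply: jlt.
Qed.

(** No run crosses a block boundary, so the product is the action of one sequence, which is the form
    of the generators of [V_Z]. *)
Lemma foldr_F_seq_cat (r : nat) (js : seq 'I_r) (s : 'I_r -> seq int) u :
  pairwise (fun i j : 'I_r => (i < j)%N) js ->
  (forall i j : 'I_r, (i < j)%N -> forall x, x \in s i -> x \notin s j) ->
  foldr (fun j w => F_seq (s j) w) u js = F_seq (flatten [seq s j | j <- js]) u.
Proof.
move=> pw dj; elim: js pw => //= j js IH /andP[/allP jlt pw].
rewrite F_seq_cat ?IH // => x xj; apply/negP => /flatten_mapP[i ijs].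
by apply/negP; apply: dj xj; apply: jlt.
Qed.

Lemma pairwise_enum_ord r : pairwise (fun i j : 'I_r => (i < j)%N) (enum 'I_r).
Proof.
rewrite -(pairwise_map (@nat_of_ord r) ltn) -[map _ _]/(map val _) val_enum_ord.
by rewrite -sorted_pairwise ?iota_ltn_sorted //; apply: ltn_trans.
Qed.

Lemma F_R_ket v S : symbols v S -> F_R v (ket S).
Proof.
move=> vS; rewrite -[ket S]scale1r; apply: span_gen; first exact: regular_at0_1.
by exists S.
Qed.

Lemma F_RZ v c u : regular_at0 c -> F_R v u -> F_R v (c *: u).
Proof.
move=> rc; move: u; apply: span_ind => [|u w Ru Rw|d _ rd [S vS <-]].
- by rewrite scaler0; apply: span0.
- by rewrite scalerDr; apply: (spanD Ru Rw).
by rewrite scalerA; apply: span_gen; [apply: regular_at0M|exists S].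
Qed.

Lemma F_R_tens v w x y : F_R v x -> F_R w y -> F_R (v ++ w) (tens x y).
Proof.
move=> Rx; move: y; apply: span_ind => [|y y' Ry Ry'|d _ rd [T wT <-]].
- by rewrite tens0r; apply: span0.
- by rewrite tensDr; apply: (spanD Ry Ry').
rewrite tensZr; apply: F_RZ => //; move: x Rx.
apply: span_ind => [|x x' Rx Rx'|c _ rc [S vS <-]].
- by rewrite tens0l; apply: span0.
- by rewrite tensDl; apply: (spanD Rx Rx').
rewrite tensZl tens_ket; apply: F_RZ => //; apply: F_R_ket.
by rewrite /symbols /multicharge /= map_cat; congr (_ ++ _).
Qed.

Lemma expansion_sub (K : fieldType) (W : lmodType K) (c : K) (x y z t : W) :
  x + c *: y + (c *: z + c *: t) - x = c *: (z + y + t).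
Proof.
by rewrite -[X in X - x]addrA [X in X - x]addrC addrK !scalerDr addrA [c *: y + _]addrC.
Qed.

(** Expanding (a + q w)(b + q w') leaves, besides ab, the multiple q (wb + aw' + q ww') with a
    bracket over R. *)
Lemma bigtens_congr_ket (I : eqType) (js : seq I) (vb : I -> seq int)
    (Sb : I -> symbol) (u : I -> Fock) :
  (forall j, j \in js -> symbols (vb j) (Sb j) /\
     exists2 w, F_R (vb j) w & u j - ket (Sb j) = q *: w) ->
  exists2 w, F_R (flatten [seq vb j | j <- js]) w &
    \big[tens/ket [::]]_(j <- js) u j - ket (flatten [seq Sb j | j <- js]) = q *: w.
Proof.
elim: js => [|j js IH] uP.
  by exists 0; [exact: span0|rewrite big_nil subrr scaler0].
have [vS [w Rw uE]] := uP j (mem_head _ _).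
have [i ijs|w' Rw' u'E] := IH; first by apply: uP; rewrite inE ijs orbT.
have vS' : symbols (flatten [seq vb i | i <- js]) (flatten [seq Sb i | i <- js]).
  rewrite /symbols /multicharge /= map_flatten -map_comp; congr flatten.
  apply/eq_in_map => i ijs /=; apply: (proj1 (uP i _)); by rewrite inE ijs orbT.
have {}uE : u j = ket (Sb j) + q *: w by rewrite -uE addrC subrK.
have {}u'E : \big[tens/ket [::]]_(j <- js) u j =
    ket (flatten [seq Sb j | j <- js]) + q *: w' by rewrite -u'E addrC subrK.
set a := ket (Sb j) in uE; set b := ket (flatten _) in u'E.
exists (tens w b + tens a w' + q *: tens w w').
  apply: spanD; first apply: spanD.
  - by apply: F_R_tens => //; apply: F_R_ket.
  - by apply: F_R_tens => //; apply: F_R_ket.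
  by apply: F_RZ; [exact: (regular_at0_qX 1)|apply: F_R_tens].
rewrite big_cons u'E uE /= -tens_ket -/a -/b.
rewrite tensDl tensDr [X in _ + X - _]tensDr tensZr 2!tensZl.
rewrite [X in _ + (_ + _ *: X) - _]tensZr.
exact: expansion_sub.
Qed.

Lemma prod_eq0 (K : fieldType) (I : finType) (c : I -> K) (j : I) :
  c j = 0 -> \prod_i c i = 0.
Proof. by move=> cj; rewrite (bigD1 j) //= cj mul0r. Qed.

Lemma qbar_prod (I : Type) (s : seq I) (c : I -> Qq) :
  (forall i, qbar (c i) = c i) -> qbar (\prod_(i <- s) c i) = \prod_(i <- s) c i.
Proof. by move=> bar_c; rewrite rmorph_prod; apply: eq_bigr. Qed.

Lemma index_enumE (T : finType) : index_enum T = enum T.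
Proof. by rewrite /index_enum locked_withE enumT. Qed.

Lemma finite_ffun_prod (r : nat) (I : choiceType) (A : 'I_r -> set I) :
  (forall j, finite_set (A j)) ->
  finite_set [set s : {ffun 'I_r -> I} | forall j, A j (s j)].
Proof.
move=> finA; pose U : {fset I} := (\bigcup_(j <- enum 'I_r) fset_set (A j))%fset.
pose h (g : {ffun 'I_r -> U}) : {ffun 'I_r -> I} := [ffun j => val (g j)].
apply: (sub_finite_set (B := h @` [set: {ffun 'I_r -> U}])); last first.
  exact/finite_image/finite_finset.
move=> s sA; have sU j : s j \in U.
  apply/bigfcupP; exists j; first by rewrite mem_enum.
  by rewrite in_fset_set // inE; apply: sA.
by exists [ffun j => [` sU j]%fset] => //; apply/ffunP => j; rewrite !ffunE.
Qed.

(** * Cutting a symbol into blocks *)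

(** Each slice starts where the previous one stops; the predecessor converts a position counted from
    1 into a number of terms. *)
Lemma flatten_slices (T : Type) (x : seq T) (k : nat -> nat) (m : nat) :
  k 1%N = 1%N -> (forall j, (1 <= j <= m)%N -> (k j < k j.+1)%N) ->
  flatten [seq slice x (k j.+1) (k j.+2) | j <- iota 0 m] = take (k m.+1).-1 x.
Proof.
move=> k1; elim: m => [|m IH] k_lt; first by rewrite k1 take0.
rewrite -[in iota _ _]addn1 iotaD map_cat flatten_cat /= cats0 IH => [|j j_m]; last first.
  by apply: k_lt; lia.
have km : (0 < k m.+1)%N.
  by case: m {IH} k_lt => [|m] k_lt; [rewrite k1|have := k_lt m.+1; lia].
rewrite /slice add0n -takeD; congr take; have := k_lt m.+1; lia.
Qed.

Lemma slice_nth (T : eqType) (x0 x : T) (s : seq T) a b : (0 < a)%N ->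
  x \in slice s a b ->
  exists p, [/\ (a <= p.+1 < b)%N, (p < size s)%N & x = nth x0 s p].
Proof.
move=> a0 /(nthP x0)[i]; rewrite size_take_min size_drop => lt_i <-.
have {}lt_i : (i < b - a)%N && (i < size s - a.-1)%N by lia.
exists (a.-1 + i)%N; split; [lia|lia|].
by rewrite nth_take ?nth_drop //; lia.
Qed.

Lemma map_slice (T U : Type) (f : T -> U) (s : seq T) a b :
  map f (slice s a b) = slice (map f s) a b.
Proof. by rewrite /slice map_take map_drop. Qed.

Lemma standard_slice S a b : standard S -> standard (slice S a b).
Proof.
move=> stdS i; rewrite size_take_min size_drop => lt_i j.
have {}lt_i : (i.+1 < b - a)%N && (a.-1 + i.+1 < size S)%N.
  by lia.
have nthE p : (p < b - a)%N -> nth_row (slice S a b) p = nth_row S (a.-1 + p).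
  by move=> lt_p; rewrite /nth_row nth_take // nth_drop.
rewrite !nthE; try lia.
by rewrite addnS; apply: stdS; lia.
Qed.

Lemma symbol_size_flatten (I : Type) (js : seq I) (Sb : I -> symbol) (nb : I -> nat) :
  (forall j, symbol_size (Sb j) = (nb j)%:Z) ->
  symbol_size (flatten [seq Sb j | j <- js]) = (\sum_(j <- js) nb j)%N%:Z.
Proof.
move=> size_Sb; elim: js => [|j js IH]; first by rewrite big_nil /symbol_size big_nil.
by rewrite /symbol_size big_cat big_cons PoszD -IH -size_Sb.
Qed.

Lemma scale_ket_eq0 c T : c *: ket T = 0 -> c = 0.
Proof.
move/(congr1 (mcoeff T)); rewrite mcoeffZ mcoeff_ket eqxx mulr1 => ->.
exact: mcoeff0.
Qed.

(** Serves to exclude expansions with infinite support, whose sum would be 0 by convention. *)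
Lemma canonical_basis_neq0 v G S :
  is_canonical_basis v G -> standard_symbols v S -> G S <> 0.
Proof.
move=> [[_ freeG] _ _ _] DS GS0.
suff /eqP : (1 : Qq) = 0 by rewrite oner_eq0.
apply: (freeG [:: S] (fun=> 1)) (mem_head S [::]) => //.
  by move=> T; rewrite inE => /eqP ->.
by rewrite big_seq1 GS0; apply: scaler0.
Qed.

(** A vacuum row of charge c contains all integers up to c, hence x + 1, which blocks x. *)
Lemma fixed_rows_vac (v : seq int) (x : int) : (forall c, c \in v -> x < c) ->
  supported (fixed_rows x) (vac v).
Proof.
move=> x_lt; apply: supported_ket => b /mapP[c /x_lt lt_c ->].
rewrite /movable negb_and negbK; apply/orP; right; apply/asboolP.
by exists (absz (c - (x + 1))%R); rewrite /=; lia.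
Qed.

Lemma avoids_bound (v : seq int) (m : nat) (x : int) u : supported (symbol_bound v m) u ->
  (forall c, c \in v -> c + m%:Z < x) -> supported (avoids x) u.
Proof.
move=> bu x_gt S Su b bS; have [vS /(_ b bS) bb] := bu S Su.
have /x_gt lt_x : charge b \in v by rewrite -vS map_f.
by apply/andP; split; apply/negP => /(row_bound_le bb); lia.
Qed.

(** * Factorization of canonical basis elements across large gaps of the multicharge *)

Theorem proposition3p2
  (n l r : nat) (v : l.-tuple int) (k : nat -> nat)
  (hl : (1 <= l)%N) (hr : (1 <= r)%N)
  (hv : forall i j : 'I_l, (i <= j)%N -> tnth v j <= tnth v i)
  (* k_1 = 1 < k_2 < ... < k_r <= l and k_(r+1) = l+1, as positions counted from 1 *)
  (hk1 : k 1%N = 1%N) (hkr : k r.+1 = l.+1)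
  (hk_range : forall j : nat, (2 <= j <= r)%N -> (2 <= k j <= l)%N)
  (hk_incr : forall j : nat, (2 <= j < r)%N -> (k j < k j.+1)%N)
  (hgap : forall j : nat, (2 <= j <= r)%N ->
     n%:Z <= nth 0 v (k j - 1).-1 - nth 0 v (k j).-1)
  (* the block j : 'I_r is the block numbered j+1 *)
  (vb : 'I_r -> seq int)
  (hvb : forall j : 'I_r, vb j = slice v (k j.+1) (k j.+2))
  (S : symbol) (hS : symbols_of_size v n S) (hSstd : standard S)
  (Sb : 'I_r -> symbol) (nb : 'I_r -> nat)
  (hSb : forall j : 'I_r, Sb j = slice S (k j.+1) (k j.+2))
  (hnb : forall j : 'I_r, symbol_size (Sb j) = (nb j)%:Z)
  (G : symbol -> Fock) (hG : is_canonical_basis v G)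
  (Gb : 'I_r -> symbol -> Fock)
  (hGb : forall j : 'I_r, is_canonical_basis (vb j) (Gb j))
  (J : 'I_r -> set (seq int)) (a : 'I_r -> seq int -> Qq)
  (alpha : 'I_r -> symbol -> {poly int})
  (hJ_fin : forall j : 'I_r, finite_set (J j))
  (hJ_size : forall (j : 'I_r) (s : seq int), J j s -> size s = nb j)
  (* only sequences contributing a nonzero vector to G(S_j) are used *)
  (hJ_nz : forall (j : 'I_r) (s : seq int), J j s -> F_seq s (vac (vb j)) <> 0)
  (ha_laurent : forall (j : 'I_r) (s : seq int), J j s -> laurentZ (a j s))
  (ha_bar : forall (j : 'I_r) (s : seq int), J j s -> qbar (a j s) = a j s)
  (hGb_F : forall j : 'I_r,
     Gb j (Sb j) = \sum_(s \in J j) (a j s *: F_seq s (vac (vb j)) : Fock))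
  (hGb_ket : forall j : 'I_r,
     Gb j (Sb j) =
       \sum_(T \in symbols_of_size (vb j) (nb j)) (polyZ (alpha j T) *: ket T : Fock)) :
  G S = \sum_(s \in [set s : {ffun 'I_r -> seq int} | forall j, J j (s j)])
          ((\prod_(j < r) a j (s j)) *: F_seqs s (vac v) : Fock)
  /\
  G S = \sum_(T \in [set T : {ffun 'I_r -> symbol} |
                       forall j, symbols_of_size (vb j) (nb j) (T j)])
          ((\prod_(j < r) polyZ (alpha j (T j))) *: ket (stack T) : Fock).
Proof.
(* The cases j = 1 and j = r come from the two boundary values of k and the range hypothesis. *)
have k_lt j : (1 <= j <= r)%N -> (k j < k j.+1)%N.
  move=> j_r; have [->|j_lt_r] := eqVneq j r.
    rewrite hkr; case: (ltnP 1 r) => [r1|r1]; first by have := hk_range r ltac:(lia); lia.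
    by rewrite (_ : r = 1%N) ?hk1; lia.
  have [j1|j1] := eqVneq j 1%N; first by rewrite j1 hk1; have /andP[] := hk_range 2%N ltac:(lia).
  by apply: hk_incr; lia.
have k_le i j : (1 <= i)%N -> (i <= j <= r.+1)%N -> (k i <= k j)%N.
  move=> i1; elim: j => [|j IH] ij; first by lia.
  have [->|ne] := eqVneq i j.+1; first by [].
  by apply: leq_trans (IH _) (ltnW (k_lt j _)); lia.
have nth_v i j : (i <= j)%N -> (j < l)%N -> nth 0 v j <= nth 0 v i.
  move=> ij jl; have il := leq_ltn_trans ij jl.
  by have := hv (Ordinal il) (Ordinal jl) ij; rewrite !(tnth_nth 0).
(* As v is weakly decreasing, c is at least the last charge above block j and c' at most the first
   charge of block j, so the gap at that boundary bounds c - c'. *)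
have gap (i j : 'I_r) c c' : (i < j)%N -> c \in vb i -> c' \in vb j -> n%:Z <= c - c'.
  move=> ij; have ltj := ltn_ord j; rewrite !hvb.
  have k0 p : (1 <= p <= r.+1)%N -> (0 < k p)%N by have := k_le 1%N p; lia.
  case/(slice_nth 0 (k0 i.+1 ltac:(lia))) => p [pk _ ->].
  case/(slice_nth 0 (k0 j.+1 ltac:(lia))) => p' [pk' pv' ->].
  have kij := k_le i.+2 j.+1 isT ltac:(lia); rewrite size_tuple in pv'.
  have g := hgap j.+1 ltac:(lia).
  have le1 := nth_v p (k j.+1 - 1).-1 ltac:(lia) ltac:(lia).
  have le2 := nth_v (k j.+1).-1 p' ltac:(lia) pv'.
  exact: le_trans g (lerB le1 le2).
have flat_slices (T : Type) (x : seq T) : size x = l ->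
    flatten [seq slice x (k j.+1) (k j.+2) | j : 'I_r <- enum 'I_r] = x.
  move=> szx; rewrite (map_comp (fun j => slice x (k j.+1) (k j.+2)) val) val_enum_ord.
  by rewrite flatten_slices // hkr -szx take_size.
have vE : flatten [seq vb j | j <- enum 'I_r] = v.
  by rewrite (eq_map hvb) flat_slices ?size_tuple.
have [vS szS] := hS.
have SE : flatten [seq Sb j | j <- enum 'I_r] = S.
  by rewrite (eq_map hSb) flat_slices // -(size_map charge) [map _ _]vS size_tuple.
have sum_nb : (\sum_(j < r) nb j)%N = n.
  have := symbol_size_flatten (enum 'I_r) hnb.
  by rewrite SE szS big_enum /= => -[].
have nb_le (i j : 'I_r) : (i < j)%N -> (nb i + nb j <= n)%N.
  move=> ij; rewrite -sum_nb (bigD1 i) //= (bigD1 j) /=; first by lia.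
  by apply/eqP => ji; rewrite ji ltnn in ij.
have DSb j : standard_symbols (vb j) (Sb j).
  split; last by rewrite hSb; apply: standard_slice.
  by rewrite /symbols /= hSb hvb /multicharge map_slice [map _ _]vS.
have vac_v : vac v = vac (flatten [seq vb j | j <- enum 'I_r]) by rewrite vE.
set JJ := [set s : {ffun 'I_r -> seq int} | forall j, J j (s j)].
have range (s : {ffun 'I_r -> seq int}) j x : JJ s -> x \in s j ->
    exists c c', [/\ c \in vb j, c' \in vb j & c - (nb j)%:Z < x < c' + (nb j)%:Z].
  move=> /(_ j) Js; have := @F_seq_range (vb j) (s j) (hJ_nz _ _ Js) x.
  by rewrite (hJ_size _ _ Js).
have F_seqsE (s : {ffun 'I_r -> seq int}) : JJ s ->
    F_seqs s (vac v) = \big[tens/ket [::]]_(j < r) F_seq (s j) (vac (vb j)).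
  move=> Js; rewrite /F_seqs vac_v foldr_F_seq_tens; first by rewrite -index_enumE.
  - exact: pairwise_enum_ord.
  (* Here x > c - nb i >= c' + n - nb i >= c' + nb j, beyond all entries reachable in block j. *)
  - move=> i j ij x xs; apply: (avoids_bound (m := nb j) (v := vb j)).
      by rewrite -(hJ_size _ _ (Js j)); apply: F_seq_bound.
    move=> c' vc'; have [c [c1 [vc _ bnd]]] := range s i x Js xs.
    by have := gap i j c c' ij vc vc'; have := nb_le i j ij; lia.
  (* Here x < c' + nb j <= c - n + nb j <= c - nb i <= c. *)
  move=> i j ij x xs; apply: fixed_rows_vac => c vc.
  have [c2 [c' [_ vc' bnd]]] := range s j x Js xs.
  by have := gap i j c c' ij vc vc'; have := nb_le i j ij; lia.
(* This form gives both membership in [V_Z] and bar invariance. A value x common to blocks i < j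
   would satisfy c - nb i < x < c' + nb j, against c - c' >= n >= nb i + nb j. *)
have F_seqs_flatten (s : {ffun 'I_r -> seq int}) : JJ s ->
    F_seqs s (vac v) = F_seq (flatten [seq s j | j <- enum 'I_r]) (vac v).
  move=> Js; apply: foldr_F_seq_cat; first exact: pairwise_enum_ord.
  move=> i j ij x xi; apply/negP => xj.
  have [c [c1 [vc _ bnd]]] := range s i x Js xi.
  have [c2 [c' [_ vc' bnd']]] := range s j x Js xj.
  by have := gap i j c c' ij vc vc'; have := nb_le i j ij; lia.
pose X := \big[tens/ket [::]]_(j < r) Gb j (Sb j).
have XF : X = \sum_(s \in JJ) ((\prod_(j < r) a j (s j)) *: F_seqs s (vac v) : Fock).
  rewrite /X (eq_bigr _ (fun j _ => hGb_F j)) (bigtens_fsum _ hJ_fin).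
  by apply: eq_fsbigr => s /[!inE] Js; rewrite bigtensZ F_seqsE.
have XT : X = \sum_(T \in [set T : {ffun 'I_r -> symbol} |
      forall j, symbols_of_size (vb j) (nb j) (T j)])
    ((\prod_(j < r) polyZ (alpha j (T j))) *: ket (stack T) : Fock).
  pose f j T : Fock := polyZ (alpha j T) *: ket T.
  (* Restricting to the symbols with nonzero term makes the index sets finite, as distributivity
     requires. *)
  pose A j := symbols_of_size (vb j) (nb j) `&` f j @^-1` [set~ 0].
  have GA j : Gb j (Sb j) = \sum_(T \in A j) f j T.
    by rewrite hGb_ket; apply: fsbig_supp.
  have finA j : finite_set (A j).
    (* A sum with infinite support has the default value 0, but G(S_j) is nonzero. *)
    apply: contrapT => infA; apply: (canonical_basis_neq0 (hGb j) (DSb j)).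
    by rewrite hGb_ket; apply: fsbig_dflt.
  rewrite /X (eq_bigr _ (fun j _ => GA j)) (bigtens_fsum f finA).
  have fE (T : {ffun 'I_r -> symbol}) : \big[tens/ket [::]]_(j < r) f j (T j) =
      (\prod_(j < r) polyZ (alpha j (T j))) *: ket (stack T).
    by rewrite bigtensZ /stack -bigtens_ket -index_enumE.
  transitivity (\sum_(T \in [set T : {ffun 'I_r -> symbol} | forall j, A j (T j)])
    ((\prod_(j < r) polyZ (alpha j (T j))) *: ket (stack T) : Fock)).
    by apply: eq_fsbigr => T _; apply: fE.
  (* A tuple outside the restricted set has a component with zero term, hence a vanishing
     coefficient product. *)
  apply: fsbig_widen => [T AT j|T [/= sT nA]]; first by have [] := AT j.
  have [j nAj] : exists j, ~ A j (T j).
    by apply: contrapT => no; apply: nA => j; apply: contrapT => nAj; apply: no; exists j.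
  have fj0 : f j (T j) = 0 by apply: contrapT => fj; apply: nAj; split.
  by rewrite (prod_eq0 (scale_ket_eq0 fj0)); apply: scale0r.
have finJJ : finite_set JJ by apply: finite_ffun_prod.
have G_X : G S = X.
  apply: canonical_basis_unique hG _ _ _ _; first by split.
  - rewrite XF fsbig_finite //; apply: span_sum => s; rewrite in_fset_set // inE => Js.
    apply: span_gen; last by exists (flatten [seq s j | j <- enum 'I_r]); apply: F_seqs_flatten.
    elim/big_rec: _ => [|j c _ Lc]; first exact: laurentZ1.
    by apply: laurentZM => //; apply: ha_laurent.
  - move=> psi psiP; rewrite XF fsbig_finite //.
    apply: (bar_sum_fixed psiP) => s; rewrite in_fset_set // inE => Js.
    rewrite F_seqs_flatten //; split; last by apply: qbar_prod => j; apply: ha_bar.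
      apply: V_Z_sub; rewrite -[F_seq _ _]scale1r; apply: span_gen; first exact: laurentZ1.
      by eexists.
    exact: bar_F_seq psiP _.
  have [j _|w Rw wE] := @bigtens_congr_ket _ (enum 'I_r) vb Sb (fun j => Gb j (Sb j)).
    by split; [have [] := DSb j|have [_ _ _] := hGb j; apply].
  by exists w; [rewrite -vE|rewrite -SE -wE /X index_enumE].
by rewrite G_X; split.
Qed.
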